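(* Let $T\in\mathbb{R}$ and let $u\in C^{1,2}\left((-\infty,T]\times\overline{\mathbb{R}^{N+1}_+}\right)$ be a bounded real-valued solution of $\partial_tu=\mathcal Lu$ in $(-\infty,T]\times\overline{\mathbb{R}^{N+1}_+}$ satisfying the Neumann boundary condition $\lim_{y\to 0^+}y^cD_yu(t,x,y)=0$ for all $t\le T$, $x\in\mathbb{R}^N$. Then $u$ is constant.
   Context: $N\ge 0$ is an integer, $\mathbb{R}^{N+1}_+=\{z=(x,y):x\in\mathbb{R}^N,\ y>0\}$ and $\overline{\mathbb{R}^{N+1}_+}=\{y\ge 0\}$. Let $c\in\mathbb{R}$ with $c+1>0$ and $a\in\mathbb{R}^N$ with $|a|<1$, and set $$\mathcal L=\Delta_x+2a\cdot\nabla_xD_y+D_{yy}+\frac{c}{y}D_y .$$ $C^{1,2}(I\times\overline{\mathbb{R}^{N+1}_+})$, for an interval $I$, is the set of functions $u(t,z)$ such that $u$, $\partial_tu$ and all first and second order derivatives of $u$ in $z$ exist and are continuous on $I\times\overline{\mathbb{R}^{N+1}_+}$ (up to $y=0$). At $y=0$, $\mathcal L u$ is understood as the limit as $y\to0^+$. *)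

(* Defs.v *)
From HB Require Import structures.
From mathcomp Require Import all_boot all_order all_algebra.
From mathcomp Require Import all_classical all_reals all_analysis.

Set Implicit Arguments.
Unset Strict Implicit.
Unset Printing Implicit Defensive.

Import Order.TTheory GRing.Theory Num.Theory.
Import numFieldNormedType.Exports.

Local Open Scope classical_set_scope.
Local Open Scope ring_scope.

(* The norm `|a| of the library on 'rV_N is the sup norm. *)
Definition eucl_norm (R : realType) (N : nat) (a : 'rV[R]_N) : R :=
  Num.sqrt (\sum_(i < N) a 0 i ^+ 2).

(** Derivatives relative to a set: the increment p + h v is required to stay in
    D, so that they are one-sided at boundary points of D, coincide with
    [derivable] and [derive] at interior points of D, and only depend on the
    values of f on D. *)
Section derivative_within.
Context {R : realType} {V : lmodType R}.
Implicit Types (D : set V) (f : V -> R) (p v : V).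

Definition derivable_within D f p v : Prop :=
  cvg ((fun h : R => h^-1 *: (f (p + h *: v) - f p)) @
       within [set h : R | D (p + h *: v)] 0^').

Definition derive_within D f p v : R :=
  lim ((fun h : R => h^-1 *: (f (p + h *: v) - f p)) @
       within [set h : R | D (p + h *: v)] 0^').

End derivative_within.

(** A point (t, (x, y)) consists of the time t and of z = (x, y). *)
Notation spacetime R N := (R * ('rV[R]_N * R))%type.

Section space_time.
Context {R : realType} {N : nat}.
Implicit Types (I : set R) (D : set (spacetime R N)) (u : spacetime R N -> R).

Definition closed_half_space : set ('rV[R]_N * R) := [set z | 0 <= z.2].

Definition dir_t : spacetime R N := (1, (0, 0)).

(* [Some i] is the i-th direction of x, [None] is the direction of y. *)
Definition dir_z (k : option 'I_N) : spacetime R N :=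
  if k is Some i then (0, (delta_mx 0 i, 0)) else (0, (0, 1)).

Definition Dt D u : spacetime R N -> R := fun p => derive_within D u p dir_t.

Definition Dz D (k : option 'I_N) u : spacetime R N -> R :=
  fun p => derive_within D u p (dir_z k).

Definition Dx D (i : 'I_N) u : spacetime R N -> R := Dz D (Some i) u.

Definition Dy D u : spacetime R N -> R := Dz D None u.

(* The space C^{1,2}(I x closed half-space), for a nondegenerate interval I. *)
Definition C12 I u : Prop :=
  let D := I `*` closed_half_space in
  [/\ {within D, continuous u},
      (forall p, D p -> derivable_within D u p dir_t) /\
      {within D, continuous (Dt D u)},
      (forall k p, D p -> derivable_within D u p (dir_z k)) /\
      (forall k, {within D, continuous (Dz D k u)}) &
      (forall j k p, D p -> derivable_within D (Dz D k u) p (dir_z j)) /\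
      (forall j k, {within D, continuous (Dz D j (Dz D k u))})].

(* Only meaningful for y > 0, because of the coefficient c / y. *)
Definition Lop D (c : R) (a : 'rV[R]_N) u : spacetime R N -> R := fun p =>
  \sum_(i < N) Dx D i (Dx D i u) p
  + 2 * \sum_(i < N) a 0 i * Dx D i (Dy D u) p
  + Dy D (Dy D u) p
  + c / p.2.2 * Dy D u p.

(* At y = 0 the value of Lop is its limit as y -> 0+. *)
Definition solves_on I (c : R) (a : 'rV[R]_N) u : Prop :=
  let D := I `*` closed_half_space in
  forall (t : R) (x : 'rV[R]_N), I t ->
    (forall y : R, 0 < y -> Dt D u (t, (x, y)) = Lop D c a u (t, (x, y))) /\
    Lop D c a u (t, (x, y)) @[y --> 0^'+] --> Dt D u (t, (x, 0)).

Definition neumann I (c : R) u : Prop :=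
  let D := I `*` closed_half_space in
  forall (t : R) (x : 'rV[R]_N), I t ->
    y `^ c * Dy D u (t, (x, y)) @[y --> 0^'+] --> (0 : R).

End space_time.

(* Main.v *)
(** Doubling of variables and the maximum principle, with barriers that are
    translation invariant in time.

    Independence of x: for a coordinate vector e, the function
    v(t,x,s,y) = u(t,x+se,y) - u(t,x-se,y) vanishes at s = 0 and satisfies
    v_ss = v_ee, hence also v_t = L v + kappa (v_ss - v_ee), whose right-hand side
    is still elliptic for kappa = (1-|a|^2)/2. With |u| <= M, the barrier
    2M ((t1-t)/L^2 + (s/L)(2-s/L)/kappa) on [t1-L^2,t1] gives
    v(t1,.) = O(s/L), and L tends to infinity.

    Independence of y: then u(t,y) solves u_t = u_yy + (c/y) u_y, and
    y^2 - z^2 is annihilated by the operator acting on both variables of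
    u(t,y) - u(t,z), so that the barrier
    2M ((t1-t)/L^2 + sqrt(y^2-z^2)/L) is a supersolution whatever c > -1.

    Finally u_t = 0. Noncompactness is handled by a small quadratic penalization.
    At y = 0 the equation forces D_y u = 0, hence D_x D_y u = 0 and
    u_t = Delta_x u + (1+c) u_yy, which suffices at a boundary maximum. *)
Require Import Defs.
From HB Require Import structures.
From mathcomp Require Import all_boot all_order all_algebra.
From mathcomp Require Import all_classical all_reals all_analysis.
From mathcomp Require Import ring lra.

Import Order.TTheory GRing.Theory Num.Theory.
Import numFieldNormedType.Exports.

Local Open Scope classical_set_scope.
Local Open Scope ring_scope.

Set Implicit Arguments.
Unset Strict Implicit.
Unset Printing Implicit Defensive.

(** * One-sided second-order expansions *)

Lemma near_right0P (R : realType) (P : R -> Prop) :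
  (\forall h \near 0^'+, P h) <-> exists2 e : R, 0 < e & forall h, 0 < h < e -> P h.
Proof.
split=> [/nbhs_ballP[e /= e0 eP]|[e e0 eP]].
  exists e => // h /andP[h0 he]; apply: eP => //.
  by rewrite /ball /= sub0r normrN gtr0_norm.
apply/nbhs_ballP; exists e => //= h; rewrite /ball /= sub0r normrN => he h0.
by apply: eP; rewrite h0 /= (le_lt_trans (ler_norm _) he).
Qed.

Lemma within_continuous_compose (X Y Z : topologicalType) (A : set X) (B : set Y)
    (phi : X -> Y) (f : Y -> Z) :
  continuous phi -> (forall x, A x -> B (phi x)) ->
  {within B, continuous f} -> {within A, continuous (f \o phi)}.
Proof.
move=> cphi AB /subspace_continuousP cf; apply/subspace_continuousP => x Ax.
move=> S /(cf _ (AB _ Ax)) /= /(cphi x) /=; rewrite /within /= !nbhs_simpl /=.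
by apply: filterS => z /= + Az; apply; exact: AB.
Qed.

Section expansions_within.
Context {R : realType} {V : normedModType R}.
Implicit Types (D : set V) (f : V -> R) (p q v : V).

(** Division-free form with an explicit value [l]: the increment [h = 0] needs no exclusion and no
    [lim] has to be handled. Where no nonzero increment is admissible every [l] qualifies, hence the
    admissibility conditions in the uniqueness lemmas below. *)
Definition has_derivative_within D f p v (l : R) :=
  forall e : R, 0 < e -> exists2 d : R, 0 < d &
    forall h : R, `|h| < d -> D (p + h *: v) ->
      `|f (p + h *: v) - f p - h * l| <= e * `|h|.

Lemma derivable_withinP D f p v :
  derivable_within D f p v -> has_derivative_within D f p v (derive_within D f p v).
Proof.
move=> /cvgrPdist_le dfp e e0.
have /nbhs_ballP[d /= d0 dP] := dfp _ e0.
exists d => // h hd Dh.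
have [->|h0] := eqVneq h 0.
  by rewrite scale0r addr0 subrr mul0r subr0 normr0 mulr0.
have : `|derive_within D f p v - h^-1 *: (f (p + h *: v) - f p)| <= e.
  by apply: dP => //; rewrite /ball /= sub0r normrN.
have -> : f (p + h *: v) - f p - h * derive_within D f p v =
    - ((derive_within D f p v - h^-1 *: (f (p + h *: v) - f p)) * h).
  by rewrite /GRing.scale /=; field.
by rewrite normrN normrM => /ler_wpM2r; apply.
Qed.

Lemma has_derivative_withinZ D f p v l (a : R) :
  has_derivative_within D f p v l -> has_derivative_within D f p (a *: v) (a * l).
Proof.
move=> hf e e0; have a1 : 0 < 1 + `|a| by rewrite ltr_pwDl.
have [d d0 dP] := hf (e / (1 + `|a|)) (divr_gt0 e0 a1).
exists (d / (1 + `|a|)); first exact: divr_gt0.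
move=> h; rewrite ltr_pdivlMr // => hd; rewrite scalerA mulrA => Dh.
have hah : `|h * a| <= `|h| * (1 + `|a|).
  by rewrite normrM ler_wpM2l // lerDr.
apply: le_trans (dP _ _ Dh) _; first exact: le_lt_trans hd.
by rewrite mulrAC ler_pdivrMr // -mulrA ler_wpM2l // ltW.
Qed.

Lemma has_derivative_withinMl D f p v l (b : R) :
  has_derivative_within D f p v l ->
  has_derivative_within D (fun q => b * f q) p v (b * l).
Proof.
move=> hf e e0; have b1 : 0 < 1 + `|b| by rewrite ltr_pwDl.
have [d d0 dP] := hf (e / (1 + `|b|)) (divr_gt0 e0 b1).
exists d => // h hd /(dP _ hd) H.
have -> : b * f (p + h *: v) - b * f p - h * (b * l) =
  b * (f (p + h *: v) - f p - h * l) by ring.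
rewrite normrM (le_trans (ler_wpM2l _ H)) // mulrA ler_wpM2r //.
by rewrite mulrCA ler_piMr ?(ltW e0) // ler_pdivrMr // mul1r lerDr.
Qed.

(** Forward increments alone determine the derivative. In the directions of x and y they never leave
    the closed half-space, so equal increments transfer a derivative from one function or base point
    to another. *)
Lemma has_derivative_within_unique D f g p q v l k :
  has_derivative_within D f p v l -> has_derivative_within D g q v k ->
  (forall h : R, 0 < h -> [/\ D (p + h *: v), D (q + h *: v) &
    f (p + h *: v) - f p = g (q + h *: v) - g q]) -> l = k.
Proof.
move=> hf hg fg; apply/eqP; rewrite -subr_eq0 -normr_le0; apply/ler_addgt0Pr => e e0.
have e20 : 0 < e / 2 by rewrite divr_gt0.
have [d1 d10 dP1] := hf _ e20; have [d2 d20 dP2] := hg _ e20.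
pose d := Num.min d1 d2 / 2; have d0 : 0 < d by rewrite divr_gt0 // lt_min d10.
have dm : d < Num.min d1 d2 by rewrite ltr_pdivrMr // ltr_pMr ?ltr1n // lt_min d10.
have [dd1 dd2] : d < d1 /\ d < d2 by move: dm; rewrite lt_min => /andP.
have [Dp Dq fgd] := fg _ d0.
have := dP1 d _ Dp; rewrite (gtr0_norm d0) fgd => /(_ dd1).
have := dP2 d _ Dq; rewrite (gtr0_norm d0) => /(_ dd2).
have nE : d * `|l - k| = `|d * (l - k)| by rewrite normrM (gtr0_norm d0).
move=> H1 H2; rewrite add0r -(ler_pM2l d0) nE; move: H1 H2; rewrite !ler_norml; lra.
Qed.

Lemma has_derivative_within_cst D f p v l :
  has_derivative_within D f p v l ->
  (forall h : R, 0 < h -> D (p + h *: v) /\ f (p + h *: v) = f p) -> l = 0.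
Proof.
move=> hf cf; apply: (has_derivative_within_unique hf (g := fun=> 0) (q := p)).
  move=> e e0; exists 1 => // h _ _.
  by rewrite subrr mulr0 subr0 normr0 mulr_ge0 // ltW.
by move=> h /cf[Dh ->]; rewrite !subrr.
Qed.

(** Inside a segment contained in [D], small parameter increments of both signs are admissible, so
    the relative derivative is a genuine one, as the mean value theorem requires. *)
Lemma segment_is_derive D f q v (h k l : R) :
  (forall k, 0 <= k <= h -> D (q + k *: v)) -> 0 < k < h ->
  has_derivative_within D f (q + k *: v) v l ->
  is_derive k 1 (fun k => f (q + k *: v)) l.
Proof.
move=> segD /andP[k0 kh] hf.
suff H : (fun x : R => x^-1 *: (((fun k => f (q + k *: v)) \o shift k) (x *: 1) -
    f (q + k *: v))) @ (0 : R)^' --> l.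
  by apply: DeriveDef; [apply/cvg_ex; exists l|exact: cvg_lim H].
apply/cvgrPdist_le => e e0; have [d d0 dP] := hf _ e0.
apply/nbhs_ballP; exists (Num.min d (Num.min k (h - k))) => /=.
  by rewrite !lt_min d0 k0 subr_gt0 kh.
move=> x; rewrite /ball /= sub0r normrN !lt_min => /and3P[xd xk xhk] x0.
have E : q + (x *: 1 + k) *: v = q + k *: v + x *: v.
  by rewrite [x *: 1]mulr1 (addrC x) scalerDl addrA.
rewrite E -(ler_pM2r (_ : 0 < `|x|)) ?normr_gt0// -normrM.
have -> : (l - x^-1 *: (f (q + k *: v + x *: v) - f (q + k *: v))) * x =
    - (f (q + k *: v + x *: v) - f (q + k *: v) - x * l).
  by rewrite /GRing.scale /=; field.
rewrite normrN; apply: dP => //; rewrite -addrA -scalerDl; apply: segD.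
by move: xk xhk; rewrite !ltr_norml; lra.
Qed.

(** The mean value theorem is applied to [f] along the segment minus [m0 k + m1 k^2 / 2], the
    primitive of the affine approximation of [f']. With all three constants zero it yields
    constancy. *)
Lemma mean_value_bound D f f' q v (h m0 m1 e : R) : 0 < h ->
  (forall k, 0 <= k <= h -> D (q + k *: v)) -> {within D, continuous f} ->
  (forall p, D p -> has_derivative_within D f p v (f' p)) ->
  (forall k, 0 < k < h -> `|f' (q + k *: v) - m0 - m1 * k| <= e) ->
  `|f (q + h *: v) - f q - m0 * h - m1 / 2 * h ^+ 2| <= e * h.
Proof.
pose g k := f (q + k *: v) - m0 * k - m1 / 2 * k ^+ 2 => h0 segD cf df bf.
have cg : {within `[0, h], continuous g}.
  have cp c n : {within `[0, h], continuous (fun k : R => c * k ^+ n)}.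
    apply: continuous_subspaceT => k; apply: cvgM; first exact: cvg_cst.
    exact: exprn_continuous.
  have -> : g = (fun k => f (q + k *: v)) - (fun k : R => m0 * k ^+ 1)
      - (fun k : R => m1 / 2 * k ^+ 2) by [].
  apply: (within_continuousB _ (cp _ _)); apply: (within_continuousB _ (cp _ _)).
  apply: (@within_continuous_compose _ _ _ _ D (fun k : R => q + k *: v)) => //.
  by move=> k; apply: cvgD; [exact: cvg_cst|apply: cvgZr_tmp; exact: cvg_id].
have dg k : k \in `]0, h[ -> is_derive k 1 g (f' (q + k *: v) - m0 - m1 * k).
  rewrite in_itv /= => kh.
  have := segment_is_derive segD kh (df _ (segD _ _)).
  have /andP[k0 k1] := kh; rewrite !ltW // => /(_ isT) df'.
  apply: is_derive_eq; rewrite /GRing.scale /=.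
by field.
have [k kh E] := MVT h0 dg cg.
have -> : f (q + h *: v) - f q - m0 * h - m1 / 2 * h ^+ 2 = g h - g 0.
  by rewrite /g scale0r addr0; ring.
rewrite E subr0 normrM (gtr0_norm h0) ler_wpM2r ?(ltW h0) //.
by apply: bf; move: kh; rewrite in_itv.
Qed.


(** Taylor formula with Peano remainder: differentiability of [f'] at [p] makes it affine up to
    [e k], and [mean_value_bound] integrates this. *)
Lemma second_order_expansion D f f' p v (r l e : R) : 0 < r -> 0 < e ->
  (forall h, 0 <= h <= r -> D (p + h *: v)) -> {within D, continuous f} ->
  (forall q, D q -> has_derivative_within D f q v (f' q)) ->
  has_derivative_within D f' p v l ->
  \forall h \near 0^'+,
    `|f (p + h *: v) - f p - h * f' p - h ^+ 2 / 2 * l| <= e * h ^+ 2.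
Proof.
move=> r0 e0 segD cf df df'; have [d d0 dP] := df' _ e0.
apply/near_right0P; exists (Num.min r d); first by rewrite lt_min r0.
move=> h /andP[h0]; rewrite lt_min => /andP[hr hd].
have segDh k : 0 <= k <= h -> D (p + k *: v) by move=> kh; apply: segD; lra.
have -> : f (p + h *: v) - f p - h * f' p - h ^+ 2 / 2 * l =
  f (p + h *: v) - f p - f' p * h - l / 2 * h ^+ 2 by field.
rewrite (_ : e * h ^+ 2 = e * h * h); last by ring.
apply: (mean_value_bound h0 segDh cf df) => k /andP[k0 kh].
rewrite (mulrC l) (le_trans (dP _ _ _)) ?gtr0_norm ?(lt_trans kh) //.
  by apply: segD; lra.
by rewrite ler_wpM2l ?ltW.
Qed.

(** Only derivatives along [v1] and [v2] are given, so the end point is reached by a leg along [v1]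
    followed by a leg along [v2]. On the second leg [f2] equals [f2 p + h l12 + k f22 p] up to o(h),
    by its derivative in [v1] at [p] and the continuity of [f22]. *)
Lemma second_order_expansion2 D f f1 f2 f22 p v1 v2 (r l11 l12 e : R) :
  0 < r -> 0 < e ->
  (forall h k, 0 <= h <= r -> 0 <= k <= r -> D (p + h *: v1 + k *: v2)) ->
  {within D, continuous f} ->
  (forall q, D q -> has_derivative_within D f q v1 (f1 q)) ->
  (forall q, D q -> has_derivative_within D f q v2 (f2 q)) ->
  has_derivative_within D f1 p v1 l11 ->
  has_derivative_within D f2 p v1 l12 ->
  {within D, continuous f2} ->
  (forall q, D q -> has_derivative_within D f2 q v2 (f22 q)) ->
  {within D, continuous f22} ->
  \forall h \near 0^'+,
    `|f (p + h *: v1 + h *: v2) - f p - h * (f1 p + f2 p) -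
      h ^+ 2 / 2 * (l11 + 2 * l12 + f22 p)| <= e * h ^+ 2.
Proof.
move=> r0 e0 segD cf df1 df2 df11 df21 cf2 df22 /subspace_continuousP cl.
have e30 : 0 < e / 3 by rewrite divr_gt0.
have Dp : D p.
  by have := segD 0 0; rewrite !scale0r !addr0 lexx ltW // => /(_ isT isT).
have seg1 h : 0 <= h <= r -> D (p + h *: v1).
  by move=> hr; rewrite -[_ + _]addr0 -(scale0r v2); apply: segD; rewrite // lexx ltW.
have /nbhs_normP[d2 /= d20 d2P] : nbhs p (fun q => D q -> `|f22 p - f22 q| <= e / 3).
  have /cvgrPdist_le/(_ _ e30) := cl _ Dp; exact.
have [d d0 dP] := df21 _ e30.
(* On the second leg the distance to [p] is at most [h K], because [k <= h]. *)
pose K := 1 + `|v1| + `|v2|.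
have K0 : 0 < K by rewrite /K -addrA ltr_pwDl // addr_ge0.
near=> h; have h0 : 0 < h by [].
have hr : h < r by near: h; exact: nbhs_right_lt.
have hd : h < d by near: h; exact: nbhs_right_lt.
have hd2 : h < d2 / K by near: h; apply: nbhs_right_lt; rewrite divr_gt0.
have E1 : `|f (p + h *: v1) - f p - h * f1 p - h ^+ 2 / 2 * l11| <= e / 3 * h ^+ 2.
  by near: h; exact: second_order_expansion seg1 cf df1 df11.
have small k : 0 < k < h -> D (p + h *: v1 + k *: v2) /\
    `|f22 p - f22 (p + h *: v1 + k *: v2)| <= e / 3.
  move=> /andP[k0 kh]; have Dk : D (p + h *: v1 + k *: v2) by apply: (segD _ _); lra.
  split=> //; apply: d2P => //=; rewrite -addrA opprD addrA subrr sub0r normrN.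
  rewrite (le_lt_trans (ler_normD _ _)) // !normrZ !gtr0_norm //.
  apply: le_lt_trans (_ : h * K < d2); last by rewrite -ltr_pdivlMr.
  have : k * `|v2| <= h * `|v2| by rewrite ler_wpM2r // ltW.
  by rewrite /K !mulrDr; lra.
(* One share [e / 3 h] comes from the derivative of [f2] along [v1], the other from the variation of
   [f22]; the remaining third is spent on the first leg in [E1]. *)
have E2 k : 0 < k < h ->
    `|f2 (p + h *: v1 + k *: v2) - (f2 p + h * l12) - f22 p * k| <= e / 3 * h * 2.
  move=> /andP[k0 kh].
  have D1 : D (p + h *: v1) by apply: (seg1 h); rewrite !ltW.
  have : `|f2 (p + h *: v1 + k *: v2) - f2 (p + h *: v1) - f22 p * k - 0 / 2 * k ^+ 2|
      <= e / 3 * k.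
    apply: (mean_value_bound k0 _ cf2 df22) => [j jk|j /andP[j0 jk]].
      by apply: (segD _ _); lra.
    by rewrite mul0r subr0 distrC; apply: (small _ _).2; lra.
  have : `|f2 (p + h *: v1) - f2 p - h * l12| <= e / 3 * h.
    by have := dP h _ D1; rewrite gtr0_norm //; exact.
  have : e / 3 * k <= e / 3 * h by rewrite ler_wpM2l ?ltW.
  rewrite !ler_norml !mul0r !subr0; lra.
have := mean_value_bound h0 _ cf df2 E2.
have -> : f (p + h *: v1 + h *: v2) - f (p + h *: v1) - (f2 p + h * l12) * h -
    f22 p / 2 * h ^+ 2 = f (p + h *: v1 + h *: v2) - f (p + h *: v1) - h * f2 p
    - h ^+ 2 * l12 - h ^+ 2 / 2 * f22 p by field.
have E3 : forall k, 0 <= k <= h -> D (p + h *: v1 + k *: v2) by move=> k kh; apply: (segD _ _); lra.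
move=> /(_ E3); move: E1; rewrite !ler_norml; lra.
Unshelve. all: by end_near. Qed.

End expansions_within.

(** * Second-order conditions at a one-sided maximum *)

Section one_sided_maximum.
Context {R : realType}.
Implicit Types w : R -> R.

(** A maximum only tests lower bounds, so expansions are kept one-sided; they remain additive, and
    the square root barrier enters through an upper bound for the root. *)
Definition lower_expansion w (v l1 l2 : R) := forall e, 0 < e ->
  \forall h \near 0^'+, v + h * l1 + h ^+ 2 / 2 * l2 - e * h ^+ 2 <= w h.

Lemma lower_expansionD w1 w2 (v1 v2 l1 l2 k1 k2 : R) :
  lower_expansion w1 v1 l1 l2 -> lower_expansion w2 v2 k1 k2 ->
  lower_expansion (fun h => w1 h + w2 h) (v1 + v2) (l1 + k1) (l2 + k2).
Proof.
move=> H1 H2 e e0; have e20 : 0 < e / 2 by rewrite divr_gt0.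
near=> h; have : v1 + h * l1 + h ^+ 2 / 2 * l2 - e / 2 * h ^+ 2 <= w1 h.
  by near: h; exact: H1.
have : v2 + h * k1 + h ^+ 2 / 2 * k2 - e / 2 * h ^+ 2 <= w2 h.
  by near: h; exact: H2.
lra.
Unshelve. all: by end_near. Qed.

Lemma lower_expansion_quad (c0 c1 c2 : R) :
  lower_expansion (fun h => c0 + c1 * h + c2 * h ^+ 2) c0 c1 (2 * c2).
Proof.
move=> e e0; near=> h; have : 0 <= e * h ^+ 2 by rewrite mulr_ge0 ?sqr_ge0 // ltW.
lra.
Unshelve. all: by end_near. Qed.

(** The two-sided expansion of [w] admits a factor [b] of either sign, as differences of values of u
    require. *)
Lemma lower_expansionZ w (v l1 l2 b : R) :
  (forall e, 0 < e -> \forall h \near 0^'+,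
    `|w h - v - h * l1 - h ^+ 2 / 2 * l2| <= e * h ^+ 2) ->
  lower_expansion (fun h => b * w h) (b * v) (b * l1) (b * l2).
Proof.
move=> H e e0; have b1 : 0 < 1 + `|b| by rewrite ltr_pwDl.
near=> h.
have H1 : `|w h - v - h * l1 - h ^+ 2 / 2 * l2| <= e / (1 + `|b|) * h ^+ 2.
  by near: h; apply: H; rewrite divr_gt0.
have : `|b * (w h - v - h * l1 - h ^+ 2 / 2 * l2)| <= e * h ^+ 2.
  rewrite normrM (le_trans (ler_wpM2l _ H1)) // mulrA ler_wpM2r ?sqr_ge0 //.
  by rewrite mulrCA ler_piMr ?(ltW e0) // ler_pdivrMr // mul1r lerDr.
by rewrite ler_norml => /andP[+ _]; lra.
Unshelve. all: by end_near. Qed.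

Lemma lower_expansion_pZ w (v l1 l2 b : R) : 0 <= b -> lower_expansion w v l1 l2 ->
  lower_expansion (fun h => b * w h) (b * v) (b * l1) (b * l2).
Proof.
move=> b0 H e e0; have b1 : 0 < 1 + b by rewrite ltr_pwDl.
near=> h.
have H1 : v + h * l1 + h ^+ 2 / 2 * l2 - e / (1 + b) * h ^+ 2 <= w h.
  by near: h; apply: H; rewrite divr_gt0.
have := ler_wpM2l b0 H1.
have : b * (e / (1 + b) * h ^+ 2) <= e * h ^+ 2.
  rewrite mulrA ler_wpM2r ?sqr_ge0 // mulrCA ler_piMr ?(ltW e0) //.
  by rewrite ler_pdivrMr // mul1r lerDr.
rewrite !mulrDr !mulrN; lra.
Unshelve. all: by end_near. Qed.

(** A positive linear term, or a positive quadratic one when the linear one vanishes, would push [w]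
    above [v] for small [h]. *)
Lemma lower_expansion_max w (v l1 l2 : R) : lower_expansion w v l1 l2 ->
  (\forall h \near 0^'+, w h <= v) -> l1 <= 0 /\ (l1 = 0 -> l2 <= 0).
Proof.
move=> lw /near_right0P[r r0 wr]; split=> [|l10]; rewrite leNgt; apply/negP => l0.
  have /near_right0P[d d0 dP] := lw 1 ltr01.
  pose m := Num.min r d; have m0 : 0 < m by rewrite lt_min r0.
  pose K := 1 + `|l2|; have K0 : 0 < K by rewrite ltr_pwDl.
  (* With this [h] the linear term is at least [2 K h^2], while the quadratic terms are at least
     [- K h^2]. *)
  pose h := Num.min (m / 2) (l1 / (2 * K)).
  have h0 : 0 < h by rewrite lt_min !divr_gt0 // mulr_gt0.
  have hm : h < m by rewrite gt_min ltr_pdivrMr // ltr_pMr // ltr1n.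
  have [hr hd] : h < r /\ h < d by move: hm; rewrite lt_min => /andP.
  have := dP h; have := wr h; rewrite h0 hr hd => /(_ isT) w1 /(_ isT) w2.
  have hl : h * (2 * K) <= l1.
    by rewrite -ler_pdivlMr ?mulr_gt0 // ge_min lexx orbT.
  have Kl : - K <= l2 / 2 - 1.
    rewrite /K opprD addrC lerD2r; have := ler_norm (- l2); rewrite normrN.
    by have := normr_ge0 l2; lra.
  have : h ^+ 2 * (- K) <= h ^+ 2 * (l2 / 2 - 1) by rewrite ler_wpM2l ?sqr_ge0.
  have : h * (h * (2 * K)) <= h * l1 by rewrite ler_wpM2l // ltW.
  have : 0 < h * (h * K) by rewrite !mulr_gt0.
  lra.
have l20 : 0 < l2 / 4 by rewrite divr_gt0.
have /near_right0P[d d0 dP] := lw (l2 / 4) l20.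
pose h := Num.min r d / 2; have h0 : 0 < h by rewrite divr_gt0 // lt_min r0.
have hm : h < Num.min r d by rewrite ltr_pdivrMr // ltr_pMr ?ltr1n // lt_min r0.
have [hr hd] : h < r /\ h < d by move: hm; rewrite lt_min => /andP.
have := dP h; have := wr h; rewrite h0 hr hd l10 => /(_ isT) w1 /(_ isT) w2.
have : 0 < h ^+ 2 * l2 by rewrite mulr_gt0 // exprn_gt0.
lra.
Qed.

(** Squares are compared: the second-order Taylor polynomial of the root, with its quadratic
    coefficient raised by [d], has a square exceeding the radicand by [2 r d h^2] plus terms of
    order [h^3], hence it dominates the root for small [h]. *)
Lemma lower_expansion_sqrt (s b e : R) : 0 < s ->
  lower_expansion (fun h => - Num.sqrt (s + b * h + e * h ^+ 2))
    (- Num.sqrt s) (- (b / (2 * Num.sqrt s))) (b ^+ 2 / (4 * Num.sqrt s ^+ 3) - e / Num.sqrt s).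
Proof.
move=> s0 d d0; set r := Num.sqrt s.
have r0 : 0 < r by rewrite sqrtr_gt0.
have rs : r ^+ 2 = s by rewrite sqr_sqrtr // ltW.
pose m := (e / r - b ^+ 2 / (4 * r ^+ 3)) / 2 + d.
(* [C] controls the cubic term of the squared polynomial, and [q] keeps the polynomial itself
   nonnegative so that it is the root of its square. *)
pose C := 1 + `|b / r * m|; have C0 : 0 < C by rewrite ltr_pwDl.
pose q := 1 + `|b / (2 * r)| + `|m|.
have q0 : 0 < q by rewrite /q -addrA ltr_pwDl // addr_ge0.
near=> h; have h0 : 0 < h by [].
have h1 : h < 1 by near: h; exact: nbhs_right_lt.
have hC : h * C < 2 * r * d.
  rewrite -ltr_pdivlMr //; near: h; apply: nbhs_right_lt.
  by rewrite divr_gt0 // !mulr_gt0.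
have hq : h * q < r.
  by rewrite -ltr_pdivlMr //; near: h; apply: nbhs_right_lt; rewrite divr_gt0.
rewrite -/r.
suff : Num.sqrt (s + b * h + e * h ^+ 2) <= r + b / (2 * r) * h + m * h ^+ 2.
  by rewrite /m; set A := b / (2 * r); set B := e / r; set B' := b ^+ 2 / (4 * r ^+ 3); lra.
have P0 : 0 <= r + b / (2 * r) * h + m * h ^+ 2.
  have A1 : - (h * `|b / (2 * r)|) <= b / (2 * r) * h.
    by rewrite -mulrN mulrC ler_wpM2r ?(ltW h0) // lerNl -normrN ler_norm.
  have A2 : - (h * `|m|) <= m * h ^+ 2.
    rewrite lerNl -mulNr; have hh : h ^+ 2 <= h by rewrite expr2 ler_piMl // ltW.
    apply: le_trans (_ : `|m| * h ^+ 2 <= _).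
      by rewrite ler_wpM2r ?sqr_ge0 // -normrN ler_norm.
    by rewrite mulrC ler_wpM2r.
  by move: hq; rewrite /q !mulrDr; lra.
rewrite -(ger0_norm P0) -sqrtr_sqr; apply: ler_wsqrtr.
have -> : (r + b / (2 * r) * h + m * h ^+ 2) ^+ 2 = s + b * h + e * h ^+ 2 +
    h ^+ 2 * (2 * r * d + h * (b / r * m) + (m * h) ^+ 2).
  by rewrite -rs /m; field; lra.
rewrite lerDl mulr_ge0 ?sqr_ge0 //.
have : - (h * C) <= h * (b / r * m).
  rewrite -mulrN ler_wpM2l ?(ltW h0) // lerNl (le_trans (ler_norm _)) // normrN.
  by rewrite lerDr.
have := sqr_ge0 (m * h); lra.
Unshelve. all: by end_near. Qed.

Lemma near_right_affine_le (v m al : R) : v < m -> \forall h \near 0^'+, v + h * al <= m.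
Proof.
move=> vm; have b1 : 0 < 1 + `|al| by rewrite ltr_pwDl.
near=> h; have h0 : 0 < h by [].
have : h * (1 + `|al|) < m - v.
  by rewrite -ltr_pdivlMr //; near: h; apply: nbhs_right_lt; rewrite divr_gt0 // subr_gt0.
have : h * al <= h * `|al| by rewrite ler_wpM2l ?ler_norm // ltW.
by rewrite mulrDr; lra.
Unshelve. all: by end_near. Qed.

Lemma near_right_affine_ge (v m al : R) : m < v -> \forall h \near 0^'+, m <= v + h * al.
Proof.
rewrite -ltrN2 => /(near_right_affine_le (- al)); apply: filterS => h.
by rewrite mulrN -opprD lerN2.
Qed.

End one_sided_maximum.

(** * Choice of the constants of the barriers *)

Section parameters.
Context {R : realFieldType}.
Implicit Types (s A B G v M d q : R).

Lemma exists_large s A B : 0 <= A -> 0 < B -> exists2 L, s < L & A < L * B.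
Proof.
move=> A0 B0; exists (1 + `|s| + A / B).
  have := ler_norm s; have : 0 <= A / B by rewrite divr_ge0 // ltW.
  lra.
by rewrite -ltr_pdivrMr // ltrDr ltr_pwDl.
Qed.

Lemma exists_small G v : 0 <= G -> 0 < v -> exists2 d, 0 < d & d * G < v.
Proof.
move=> G0 v0; have G1 : 0 < G + 1 by rewrite ltr_wpDl.
exists (v / (G + 1)); first exact: divr_gt0.
by rewrite mulrAC ltr_pdivrMr // ltr_pM2l // ltrDl.
Qed.

Lemma exists_radius M d q : 0 <= M -> 0 < d -> exists r, [/\ 0 < r, M <= d * r ^+ 2 & q <= r].
Proof.
move=> M0 d0; have Md : 0 <= M / d by rewrite divr_ge0 // ltW.
have q0 := normr_ge0 q; have r1 : 1 <= 1 + M / d + `|q| by rewrite -addrA lerDl addr_ge0.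
exists (1 + M / d + `|q|); split; first exact: lt_le_trans r1.
- rewrite mulrC -ler_pdivrMr //; apply: (@le_trans _ _ (1 + M / d + `|q|)); last first.
    by rewrite expr2 ler_peMl // (le_trans ler01).
  by rewrite (addrC 1) -addrA lerDl addr_ge0.
- by rewrite (le_trans (ler_norm q)) // lerDr addr_ge0.
Qed.

Lemma norm_le_sqr s : `|s| <= 1 + s ^+ 2.
Proof.
have := sqr_ge0 (s - 1); have := sqr_ge0 (s + 1); have := sqr_ge0 s.
by rewrite ler_norml !expr2; lra.
Qed.

End parameters.

(** * Solutions up to the boundary *)

Lemma cvg_sum_seq (R : realType) (I T : Type) (F : set_system T) {FF : Filter F}
    (s : seq I) (f : I -> T -> R) (l : I -> R) :
  (forall i, f i @ F --> l i) ->
  (fun x => \sum_(i <- s) f i x) @ F --> \sum_(i <- s) l i.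
Proof.
move=> fl; elim: s => [|i s IHs].
  by rewrite big_nil; under eq_fun do rewrite big_nil; exact: cvg_cst.
by rewrite big_cons; under eq_fun do rewrite big_cons; exact: cvgD.
Qed.

Section solution_jet.
Context {R : realType} {N : nat}.
Variables (c : R) (a : 'rV[R]_N) (T : R).

Definition past : set (spacetime R N) := `]-oo, T] `*` closed_half_space.

Lemma pastP t x y : past (t, (x, y)) <-> t <= T /\ 0 <= y.
Proof.
split=> [[/= tT y0]|[tT y0]]; first by move: tT; rewrite in_itv.
by split=> //=; rewrite in_itv.
Qed.

(** The part of L that is continuous up to y = 0; the singular term is kept apart so that its limit
    can be isolated. *)
Definition principal_part (uzz : option 'I_N -> option 'I_N -> spacetime R N -> R)
    (p : spacetime R N) : R :=
  \sum_(i < N) uzz (Some i) (Some i) p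
  + 2 * \sum_(i < N) a 0 i * uzz (Some i) None p + uzz None None p.

(* [ut], [uz k] and [uzz j k] are the derivatives of [u], abstracted because
   conversion tests on [derive_within] are expensive. *)
Record solution_jet (u ut : spacetime R N -> R)
    (uz : option 'I_N -> spacetime R N -> R)
    (uzz : option 'I_N -> option 'I_N -> spacetime R N -> R) : Prop := SolutionJet {
  jet_continuous : {within past, continuous u};
  jet_continuous1 k : {within past, continuous (uz k)};
  jet_continuous2 j k : {within past, continuous (uzz j k)};
  jet_derivative_t p : past p -> has_derivative_within past u p dir_t (ut p);
  jet_derivative_z k p : past p -> has_derivative_within past u p (dir_z k) (uz k p);
  jet_derivative_zz j k p : past p ->
    has_derivative_within past (uz k) p (dir_z j) (uzz j k p);
  jet_interior t x y : t <= T -> 0 < y ->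
    ut (t, (x, y)) = principal_part uzz (t, (x, y)) + c / y * uz None (t, (x, y));
  jet_boundary t x : t <= T ->
    (fun y => principal_part uzz (t, (x, y)) + c / y * uz None (t, (x, y))) @ 0^'+
      --> ut (t, (x, 0));
  jet_neumann t x : t <= T -> y `^ c * uz None (t, (x, y)) @[y --> 0^'+] --> (0 : R)
}.

Lemma solution_jet_exists (u : spacetime R N -> R) :
  C12 `]-oo, T] u -> solves_on `]-oo, T] c a u -> neumann `]-oo, T] c u ->
  exists ut uz uzz, solution_jet u ut uz uzz.
Proof.
move=> [cu [dut _] [duz cuz] [duzz cuzz]] hsol hneu.
exists (Dt past u), (fun k => Dz past k u), (fun j k => Dz past j (Dz past k u)).
have itT t : t <= T -> `]-oo, T]%classic t by move=> tT; rewrite /= in_itv.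
split=> //.
- by move=> p Dp; apply: derivable_withinP; exact: dut.
- by move=> k p Dp; apply: derivable_withinP; exact: duz.
- by move=> j k p Dp; apply: derivable_withinP; exact: duzz.
- by move=> t x y tT; have [+ _] := hsol t x (itT _ tT); exact.
- by move=> t x tT; have [_ +] := hsol t x (itT _ tT); exact.
Qed.

End solution_jet.

Arguments jet_continuous1 {R N c a T u ut uz uzz} _ k.
Arguments jet_continuous2 {R N c a T u ut uz uzz} _ j k.
Arguments jet_boundary {R N c a T u ut uz uzz} _ t x _.
Arguments jet_neumann {R N c a T u ut uz uzz} _ t x _.

(** * Boundary identities and expansions of a solution *)

Section jet_properties.
Context {R : realType} {N : nat} {c : R} {a : 'rV[R]_N} {T : R}
  {u ut : spacetime R N -> R} {uz : option 'I_N -> spacetime R N -> R}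
  {uzz : option 'I_N -> option 'I_N -> spacetime R N -> R}.
Hypothesis uJ : solution_jet c a T u ut uz uzz.
Implicit Types (f : spacetime R N -> R) (t y : R) (x : 'rV[R]_N).

Local Notation D := (@past R N T).

Lemma cvg_to_boundary f t x : {within D, continuous f} -> t <= T ->
  f (t, (x, y)) @[y --> 0^'+] --> f (t, (x, 0)).
Proof.
move=> /subspace_continuousP cf tT S fS.
have := cf (t, (x, 0)); rewrite pastP => /(_ (conj tT (lexx _)))/(_ S fS).
rewrite /= /within /= => nS.
have : (fun y => (t, (x, y))) @ (0 : R) --> ((t, (x, 0)) : spacetime R N).
  exact: cvg_pair (cvg_cst t) (cvg_pair (cvg_cst x) cvg_id).
move=> /(_ _ nS); rewrite /= !nbhs_simpl /= => H.
by move: H; apply: filterS => y H y0; apply: H; apply/pastP; split=> //; exact: ltW.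
Qed.

Lemma cvg_principal_part t x : t <= T ->
  (fun y => principal_part a uzz (t, (x, y))) @ 0^'+ --> principal_part a uzz (t, (x, 0)).
Proof.
move=> tT; have cz j k := @cvg_to_boundary _ t x (jet_continuous2 uJ j k) tT.
apply: cvgD; last exact: cz.
apply: cvgD; first by apply: cvg_sum_seq => i; exact: cz.
by apply: cvgMl_tmp; apply: cvg_sum_seq => i; apply: cvgMl_tmp; exact: cz.
Qed.

(** If [c = 0], the Neumann condition itself reads D_y u -> 0. Otherwise L u and its principal part
    both have limits at y = 0, so [(c / y) D_y u] has one, and multiplying by [y / c] gives D_y u ->
    0. Continuity of D_y u identifies the boundary value. *)
Lemma uz_boundary t x : t <= T -> uz None (t, (x, 0)) = 0.
Proof.
move=> tT; have cuz := @cvg_to_boundary _ t x (jet_continuous1 uJ None) tT.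
have [c0|c0] := eqVneq c 0.
  have := jet_neumann uJ t x tT; rewrite c0; under eq_fun do rewrite powRr0 mul1r.
  by move/(norm_cvg_unique cuz).
have y0 : (fun y : R => y / c) @ 0^'+ --> 0 / c.
  by apply: cvg_at_right_filter; apply: cvgMr_tmp; exact: cvg_id.
have := cvgM y0 (cvgB (jet_boundary uJ t x tT) (@cvg_principal_part t x tT)).
rewrite mul0r mul0r => /(_ _ _) H.
suff : (fun y => uz None (t, (x, y))) @ 0^'+ --> 0 by move/(norm_cvg_unique cuz).
apply: (cvg_trans _ H); apply: near_eq_cvg; near=> y.
set P := principal_part a uzz.
rewrite -[LHS]/(y / c * (P (t, (x, y)) + c / y * uz None (t, (x, y)) - P (t, (x, y)))).
have y1 : y != 0 by rewrite gt_eqF.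
by field; apply/andP.
Unshelve. all: by end_near. Qed.

Lemma uz_x_boundary i t x : t <= T -> uzz (Some i) None (t, (x, 0)) = 0.
Proof.
move=> tT; have Dp : D (t, (x, 0)) by rewrite pastP.
apply: (has_derivative_within_cst (jet_derivative_zz uJ (Some i) None Dp)) => h h0.
have -> : (t, (x, 0)) + h *: dir_z (Some i) = (t, (x + h *: delta_mx 0 i, 0)).
  by apply: injective_projections => /=; [|apply: injective_projections => /=];
    rewrite ?scaler0 ?addr0.
by rewrite pastP !uz_boundary.
Qed.

(** Since D_y u = 0 at y = 0, [D_y u / y] is a difference quotient tending to D_yy u, so the
    singular term contributes [c D_yy u]; the mixed terms vanish because D_y u is zero all along the
    boundary. *)
Lemma equation_boundary t x : t <= T -> let p := (t, (x, 0)) in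
  ut p = \sum_(i < N) uzz (Some i) (Some i) p + (1 + c) * uzz None None p.
Proof.
move=> tT /=; have Dp : D (t, (x, 0)) by rewrite pastP.
suff H : (fun y => principal_part a uzz (t, (x, y)) + c / y * uz None (t, (x, y))) @ 0^'+
    --> \sum_(i < N) uzz (Some i) (Some i) (t, (x, 0)) + (1 + c) * uzz None None (t, (x, 0)).
  exact: norm_cvg_unique (jet_boundary uJ t x tT) H.
have : (fun y => c * (uz None (t, (x, y)) / y)) @ 0^'+ -->
    c * uzz None None (t, (x, 0)).
  apply: cvgMl_tmp; apply/cvgrPdist_le => e e0.
  have [d d0 dP] := jet_derivative_zz uJ None None Dp e0.
  near=> y; have y0 : 0 < y by [].
  have E : (t, (x, 0)) + y *: dir_z None = (t, (x, y)).
    by apply: injective_projections => /=; [|apply: injective_projections => /=];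
      rewrite ?scaler0 ?addr0 ?add0r //; exact: mulr1.
  have := dP y; rewrite E pastP uz_boundary // gtr0_norm // subr0.
  have yd : y < d by near: y; exact: nbhs_right_lt.
  rewrite yd tT ltW // => /(_ isT (conj isT isT)).
  have y1 : y != 0 by rewrite gt_eqF.
  have divE (A B : R) : A - B / y = - ((B - y * A) / y) by field.
  rewrite divE.
  by rewrite normrN normrM normfV (gtr0_norm y0) ler_pdivrMr.
move/(cvgD (@cvg_principal_part t x tT)); rewrite {2}/principal_part.
under [X in _ + 2 * X + _]eq_bigr do rewrite uz_x_boundary // mulr0.
rewrite big1_eq mulr0 addr0 mulrDl mul1r addrA; apply: cvg_trans.
apply: near_eq_cvg; near=> y; congr (_ + _).
by rewrite mulrA mulrAC.
Unshelve. all: by end_near. Qed.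

(** The disjunction describes the admissible slopes: any slope above the boundary, only inward or
    tangential ones on it. *)
Lemma motion_in_half_space y (be : R) : 0 < y \/ y = 0 /\ 0 <= be ->
  exists2 r, 0 < r & forall k, 0 <= k <= r -> 0 <= y + k * be.
Proof.
case=> [y0|[-> be0]]; last by exists 1 => // k /andP[k0 _]; rewrite add0r mulr_ge0.
have b1 : 0 < 1 + `|be| by rewrite ltr_pwDl.
exists (y / (1 + `|be|)); first by rewrite divr_gt0.
move=> k /andP[k0]; rewrite ler_pdivlMr // => H.
have : - (k * `|be|) <= k * be by rewrite -mulrN ler_wpM2l // lerNl -normrN ler_norm.
by move: H; rewrite mulrDr; lra.
Qed.

(** Moving in x_i before y makes the mixed derivative appear as the x_i-derivative of D_y u, the
    form used in L. *)
Lemma expansion_u_z i (al be : R) t x y e : t <= T -> 0 < e ->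
  0 < y \/ y = 0 /\ 0 <= be ->
  let p := (t, (x, y)) in
  \forall h \near 0^'+,
    `|u (t, (x + (h * al) *: delta_mx 0 i, y + h * be)) - u p
      - h * (al * uz (Some i) p + be * uz None p)
      - h ^+ 2 / 2 * (al ^+ 2 * uzz (Some i) (Some i) p
          + 2 * (al * be * uzz (Some i) None p) + be ^+ 2 * uzz None None p)| <= e * h ^+ 2.
Proof.
move=> tT e0 ybe p.
have [r r0 rP] := motion_in_half_space ybe.
have E h k : p + h *: (al *: dir_z (Some i)) + k *: (be *: dir_z None) =
    (t, (x + (h * al) *: delta_mx 0 i, y + k * be)).
  apply: injective_projections => /=; [|apply: injective_projections => /=].
  - by rewrite !scaler0 !addr0.
  - by rewrite !scaler0 !addr0 scalerA.
  - by rewrite !scaler0 !addr0; congr (_ + _ * _); exact: mulr1.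
under eq_near => h do rewrite -E.
have cM b f : {within D, continuous f} -> {within D, continuous (fun q => b * f q)}.
  by move=> cf q; apply: cvgMl_tmp; exact: cf.
have Dp : D p by rewrite pastP; split => //; case: ybe => [/ltW|[->]].
have -> : al ^+ 2 * uzz (Some i) (Some i) p + 2 * (al * be * uzz (Some i) None p) +
    be ^+ 2 * uzz None None p = al * (al * uzz (Some i) (Some i) p) +
    2 * (al * (be * uzz (Some i) None p)) + be * (be * uzz None None p) by ring.
apply: (second_order_expansion2 (f1 := fun q => al * uz (Some i) q)
  (f2 := fun q => be * uz None q)
  (f22 := fun q => be * (be * uzz None None q)) r0 e0 _ (jet_continuous uJ)).
- by move=> h k hr kr; rewrite E pastP; split=> //; exact: rP.
- by move=> q Dq; apply: has_derivative_withinZ; apply: (jet_derivative_z uJ).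
- by move=> q Dq; apply: has_derivative_withinZ; apply: (jet_derivative_z uJ).
- apply: has_derivative_withinZ; apply: has_derivative_withinMl.
  exact: (jet_derivative_zz uJ).
- apply: has_derivative_withinZ; apply: has_derivative_withinMl.
  exact: (jet_derivative_zz uJ).
- by apply: cM; exact: (jet_continuous1 uJ).
- move=> q Dq; apply: has_derivative_withinZ; apply: has_derivative_withinMl.
  exact: (jet_derivative_zz uJ).
- by apply: (cM be); apply: (cM be); exact: (jet_continuous2 uJ).
Qed.

(** Kept separate from the planar expansion, which needs an index of x, while [N] may be 0. *)
Lemma expansion_u_y (be : R) t x y e : t <= T -> 0 < e ->
  0 < y \/ y = 0 /\ 0 <= be ->
  let p := (t, (x, y)) in
  \forall h \near 0^'+,
    `|u (t, (x, y + h * be)) - u p - h * (be * uz None p)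
      - h ^+ 2 / 2 * (be ^+ 2 * uzz None None p)| <= e * h ^+ 2.
Proof.
move=> tT e0 ybe p.
have [r r0 rP] := motion_in_half_space ybe.
have E h : p + h *: (be *: dir_z None) = (t, (x, y + h * be)).
  apply: injective_projections => /=; [|apply: injective_projections => /=].
  - by rewrite !scaler0 addr0.
  - by rewrite !scaler0 addr0.
  - by congr (_ + _ * _); exact: mulr1.
under eq_near => h do rewrite -E.
have Dp : D p by rewrite pastP; split => //; case: ybe => [/ltW|[->]].
rewrite expr2 -mulrA.
apply: (second_order_expansion (f' := fun q => be * uz None q) r0 e0 _ (jet_continuous uJ)).
- by move=> h hr; rewrite E pastP; split=> //; exact: rP.
- by move=> q Dq; apply: has_derivative_withinZ; apply: (jet_derivative_z uJ).
- apply: has_derivative_withinZ; apply: has_derivative_withinMl.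
  exact: (jet_derivative_zz uJ).
Qed.

(** Time steps go backwards, so that they remain admissible at [t = T]. *)
Lemma expansion_u_t t x y e : t <= T -> 0 <= y -> 0 < e ->
  \forall h \near 0^'+,
    `|u (t - h, (x, y)) - u (t, (x, y)) + h * ut (t, (x, y))| <= e * h.
Proof.
move=> tT y0 e0.
have [d d0 dP] := jet_derivative_t uJ ((pastP T t x y).2 (conj tT y0)) e0.
near=> h; have h0 : 0 < h by [].
have E : (t, (x, y)) + (- h) *: dir_t = (t - h, (x, y)).
  apply: injective_projections => /=; first by congr (_ + _); exact: mulr1.
  by rewrite scaler0 addr0.
have := dP (- h); rewrite normrN gtr0_norm // mulNr opprK E; apply.
  by near: h; exact: nbhs_right_lt.
by apply/pastP; split => //; rewrite lerBlDr (le_trans tT) // lerDl ltW.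
Unshelve. all: by end_near. Qed.

End jet_properties.

(** * Independence of x *)

(* The form [|xi|^2 - ka xi_k^2 + 2 (a . xi) eta + eta^2] is a sum of
   nonnegative forms, each in a single pair [(xi_i, eta)], so second-order
   information in these planes is enough. *)
Lemma weighted_quadratic_bound (R : realFieldType) (N : nat) (k : 'I_N)
    (p q a : 'I_N -> R) (r ka d m : R) :
  0 < ka < 1 -> 0 <= d -> \sum_(i < N) a i ^+ 2 = 1 - 2 * ka ->
  (forall i be, p i + 2 * (be * q i) + be ^+ 2 * r <= 2 * d * (1 + be ^+ 2)) ->
  r <= 2 * d -> ka * p k <= m ->
  \sum_(i < N) p i + 2 * \sum_(i < N) a i * q i + r <= 2 * d * N.+1%:R + m.
Proof.
move=> /andP[ka0 ka1] d0 a2 pq rd pk.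
have ka1' : 0 < 1 - ka by rewrite subr_gt0.
(* The coordinate [k] keeps weight [1 - ka] on its square; the slope [a k / (1 - ka)] then produces
   exactly the mixed term [2 a_k q_k]. *)
have Hk : (1 - ka) * p k + 2 * (a k * q k) + a k ^+ 2 / (1 - ka) * r <=
    2 * d * (1 - ka + a k ^+ 2 / (1 - ka)).
  have := pq k (a k / (1 - ka)); rewrite -(ler_pM2l ka1').
  have -> : (1 - ka) * (p k + 2 * (a k / (1 - ka) * q k) + (a k / (1 - ka)) ^+ 2 * r) =
    (1 - ka) * p k + 2 * (a k * q k) + a k ^+ 2 / (1 - ka) * r.
    by field; rewrite gt_eqF.
  have -> // : (1 - ka) * (2 * d * (1 + (a k / (1 - ka)) ^+ 2)) =
    2 * d * (1 - ka + a k ^+ 2 / (1 - ka)).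
  by field; rewrite gt_eqF.
(* The other coordinates use the slope [a i], each consuming a share [a_i^2] of the coefficient of
   [r]. *)
have Hi : \sum_(i < N | i != k) p i + 2 * \sum_(i < N | i != k) a i * q i +
    (\sum_(i < N | i != k) a i ^+ 2) * r <=
    2 * d * (\sum_(i < N | i != k) (1 + a i ^+ 2)).
  rewrite mulr_sumr mulr_sumr mulr_suml -!big_split /=.
  by apply: ler_sum => i _; exact: pq.
have cardN : \sum_(i < N | i != k) (1 + a i ^+ 2) =
    N%:R - 1 + \sum_(i < N | i != k) a i ^+ 2.
  rewrite big_split /=; congr (_ + _).
  have : \sum_(i < N) (1 : R) = N%:R by rewrite sumr_const card_ord.
  by rewrite (bigD1 k) //= => <-; rewrite [RHS]addrC addKr.
move: a2 Hi; rewrite cardN (bigD1 k) //= (bigD1 k (P := predT)) //= (bigD1 k (P := predT)) //=.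
set S := \sum_(i < N | i != k) a i ^+ 2; set P := \sum_(i < N | i != k) p i.
set Q := \sum_(i < N | i != k) _ => a2 Hi.
have S0 : 0 <= S by apply: sumr_ge0 => i _; exact: sqr_ge0.
clearbody S P Q; clear cardN pq.
(* The coefficient of [r] left over is nonnegative, since
   [(1 - S) (1 - ka) - a_k^2 = ka (1 + S)]. *)
have rho : 0 <= 1 - S - a k ^+ 2 / (1 - ka).
  have -> : a k ^+ 2 = 1 - 2 * ka - S by rewrite -a2 addrK.
  rewrite subr_ge0 ler_pdivrMr //.
  have : 0 <= ka * S by rewrite mulr_ge0 // ltW.
  lra.
have := mulr_ge0 d0 (ltW ka0); have := ler_wpM2l rho rd; move: Hk; rewrite -(addn1 N) natrD.
move: (a k ^+ 2 / (1 - ka)) (a k * q k) => A B.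
lra.
Qed.

Section independence_of_x.
Context {R : realType} {N : nat} {c : R} {a : 'rV[R]_N} {T : R}
  {u ut : spacetime R N -> R} {uz : option 'I_N -> spacetime R N -> R}
  {uzz : option 'I_N -> option 'I_N -> spacetime R N -> R}.
Hypothesis uJ : solution_jet c a T u ut uz uzz.
(** [b] is a sign; its values 1 and -1 will give two opposite inequalities. *)
Variables (k : 'I_N) (b : R).
Hypothesis b2 : b ^+ 2 = 1.

(* The barrier described at the top of the file is obtained for [m = 2 M / L ^+ 2]; the term in
   [d] is the penalization. *)
Definition doubled_x (m ka d K t1 t0 L : R) (q : R * ('rV[R]_N * (R * R))) : R :=
  let: (t, (x, (s, y))) := q in
  u (t, (x + (s * b) *: delta_mx 0 k, y)) - u (t, (x - (s * b) *: delta_mx 0 k, y))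
  - m * (t1 - t) - m / ka * (s * (2 * L - s))
  - d * (\sum_(i < N) x 0 i ^+ 2 + y ^+ 2 + K * (t - t0)).

Lemma sum_sqr_shift (x : 'rV[R]_N) i (h : R) :
  \sum_(j < N) (x + h *: delta_mx 0 i) 0 j ^+ 2 =
  \sum_(j < N) x 0 j ^+ 2 + 2 * h * x 0 i + h ^+ 2.
Proof.
rewrite (bigD1 i) //= [in RHS](bigD1 i) //= !mxE !eqxx mulr1.
under eq_bigr => j ji do rewrite !mxE (negbTE ji) mulr0 addr0.
ring.
Qed.

(** Let v be the difference of the two values of u. The backward time step gives [v_t >= d K - m],
    the direction s gives [ka v_ee <= - 2 m], and the planes (x_i, y) control the rest, so that
    [L v <= 2 d (N + 1 + c) - 2 m]. With [K > 2 (N + 1 + c)] this forces [m < 0]. *)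
Lemma doubled_x_no_max (m ka d K t1 t0 L t s y : R) (x : 'rV[R]_N) :
  0 < ka < 1 -> \sum_(i < N) a 0 i ^+ 2 = 1 - 2 * ka -> 0 < 1 + c ->
  0 <= m -> 0 < d -> 2 * (N.+1%:R + c) < K -> t <= T -> 0 <= y ->
  let w := doubled_x m ka d K t1 t0 L in
  (\forall h \near 0^'+, w (t - h, (x, (s, y))) <= w (t, (x, (s, y)))) ->
  (forall i (al be : R), 0 < y \/ y = 0 /\ 0 <= be ->
    \forall h \near 0^'+,
      w (t, (x + (h * al) *: delta_mx 0 i, (s, y + h * be))) <= w (t, (x, (s, y)))) ->
  (forall si, \forall h \near 0^'+,
    w (t, (x, (s + h * si, y))) <= w (t, (x, (s, y)))) ->
  False.
Proof.
move=> ka01 a2 c1 m0 d0 KN tT y0 w maxt maxz maxs.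
pose A : spacetime R N := (t, (x + (s * b) *: delta_mx 0 k, y)).
pose B : spacetime R N := (t, (x - (s * b) *: delta_mx 0 k, y)).
have [ka0 ka1] := andP ka01.
have Dt1 : d * K - m <= ut A - ut B.
  apply/ler_addgt0Pr => e e0; have e20 : 0 < e / 2 by rewrite divr_gt0.
  have [h [h0 []]] : exists h, 0 < h /\ (w (t - h, (x, (s, y))) <= w (t, (x, (s, y))) /\
    (`|u (t - h, A.2) - u A + h * ut A| <= e / 2 * h /\
     `|u (t - h, B.2) - u B + h * ut B| <= e / 2 * h)).
    near (0 : R)^'+ => h; exists h; split => //; split; first by near: h.
    by split; near: h; exact: (expansion_u_t uJ).
  rewrite /w /doubled_x !ler_norml /=.
  rewrite -[(t, (x + _, y))]/A -[(t, (x - _, y))]/B => w1 [].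
  move: (u A) (u B) (ut A) (ut B) (u (t - h, (x + _, y))) (u (t - h, (x - _, y))) w1.
  by move=> *; rewrite -(ler_pM2l h0); lra.
have Dz i (al be : R) : 0 < y \/ y = 0 /\ 0 <= be ->
    al * (uz (Some i) A - uz (Some i) B) + be * (uz None A - uz None B)
      - 2 * d * (al * x 0 i + be * y) <= 0 /\
    (al * (uz (Some i) A - uz (Some i) B) + be * (uz None A - uz None B)
      - 2 * d * (al * x 0 i + be * y) = 0 ->
     al ^+ 2 * (uzz (Some i) (Some i) A - uzz (Some i) (Some i) B)
      + 2 * (al * be * (uzz (Some i) None A - uzz (Some i) None B))
      + be ^+ 2 * (uzz None None A - uzz None None B)
      - 2 * d * (al ^+ 2 + be ^+ 2) <= 0).
  move=> ybe.
  have EA := lower_expansionZ 1 (fun e (e0 : 0 < e) => @expansion_u_z _ _ _ _ _ _ _ _ _ uJ i al be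
    t (x + (s * b) *: delta_mx 0 k) y e tT e0 ybe).
  have EB := lower_expansionZ (- 1) (fun e (e0 : 0 < e) => @expansion_u_z _ _ _ _ _ _ _ _ _ uJ i al be
    t (x - (s * b) *: delta_mx 0 k) y e tT e0 ybe).
  pose X := \sum_(i < N) x 0 i ^+ 2.
  pose W0 := - m * (t1 - t) - m / ka * (s * (2 * L - s)) - d * (X + y ^+ 2 + K * (t - t0)).
  have EQ := lower_expansion_quad W0 (- d * (2 * al * x 0 i + 2 * be * y))
    (- d * (al ^+ 2 + be ^+ 2)).
  have := lower_expansion_max (lower_expansionD (lower_expansionD EA EB) EQ).
  have H : \forall h \near (0 : R)^'+,
    1 * u (t, (x + (s * b) *: delta_mx 0 k + (h * al) *: delta_mx 0 i, y + h * be)) +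
    - 1 * u (t, (x - (s * b) *: delta_mx 0 k + (h * al) *: delta_mx 0 i, y + h * be)) +
    (W0 + - d * (2 * al * x 0 i + 2 * be * y) * h + - d * (al ^+ 2 + be ^+ 2) * h ^+ 2)
    <= 1 * u A + - 1 * u B + W0.
    apply: filterS (maxz i al be ybe) => h.
    rewrite /w /doubled_x sum_sqr_shift -/X !(addrAC x (_ *: delta_mx 0 i)) -/A -/B /W0.
    move: (u _) (u _) (u _) (u _) => *; lra.
  move=> /(_ H); rewrite -/A -/B => -[H1 H2].
  split; first by move: H1; lra.
  by move=> E; have : _ <= 0 := H2 _; lra.
(* Along s the two points move in opposite directions: first derivatives add up, while the second
   ones, with factor [b ^+ 2 = 1], still subtract. This is the identity v_ss = v_ee. *)
have Ds si : si * (b * (uz (Some k) A + uz (Some k) B) - m / ka * (2 * L - 2 * s)) <= 0 /\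
    (si * (b * (uz (Some k) A + uz (Some k) B) - m / ka * (2 * L - 2 * s)) = 0 ->
     si ^+ 2 * (uzz (Some k) (Some k) A - uzz (Some k) (Some k) B + 2 * (m / ka)) <= 0).
  have y00 : 0 < y \/ y = 0 /\ 0 <= (0 : R).
    by move: y0; rewrite le_eqVlt => /predU1P[<-|]; [right|left].
  have EA := lower_expansionZ 1 (fun e (e0 : 0 < e) => @expansion_u_z _ _ _ _ _ _ _ _ _ uJ
    k (si * b) 0 t (x + (s * b) *: delta_mx 0 k) y e tT e0 y00).
  have EB := lower_expansionZ (- 1) (fun e (e0 : 0 < e) => @expansion_u_z _ _ _ _ _ _ _ _ _
    uJ k (- (si * b)) 0 t (x - (s * b) *: delta_mx 0 k) y e tT e0 y00).
  pose X := \sum_(i < N) x 0 i ^+ 2.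
  pose W0 := - m * (t1 - t) - m / ka * (s * (2 * L - s)) - d * (X + y ^+ 2 + K * (t - t0)).
  have EQ := lower_expansion_quad W0 (- (m / ka) * (si * (2 * L - 2 * s)))
    (m / ka * si ^+ 2).
  have := lower_expansion_max (lower_expansionD (lower_expansionD EA EB) EQ).
  have H : \forall h \near (0 : R)^'+,
    1 * u (t, (x + (s * b) *: delta_mx 0 k + (h * (si * b)) *: delta_mx 0 k, y + h * 0)) +
    - 1 * u (t, (x - (s * b) *: delta_mx 0 k + (h * - (si * b)) *: delta_mx 0 k, y + h * 0)) +
    (W0 + - (m / ka) * (si * (2 * L - 2 * s)) * h + m / ka * si ^+ 2 * h ^+ 2)
    <= 1 * u A + - 1 * u B + W0.
    apply: filterS (maxs si) => h.
    have sE : (s + h * si) * b = s * b + h * (si * b) by ring.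
    rewrite /w /doubled_x -/X mulr0 addr0 sE mulrN scaleNr scalerDl opprD !(addrA x).
    rewrite -/A -/B /W0.
    move: (u _) (u _) (u _) (u _) (m / ka) => *; lra.
  move=> /(_ H); rewrite -/A -/B => -[H1 H2].
  split; first by move: H1; lra.
  have b2' : (si * b) ^+ 2 = si ^+ 2 by rewrite exprMn b2 mulr1.
  move=> E; move: H2; rewrite sqrrN b2' => H2; have : _ <= 0 := H2 _; lra.
(* Both signs of [si] are admissible, so the first-order term vanishes and the second-order test
   applies; the barrier contributes [2 m / ka]. *)
have Pkk : ka * (uzz (Some k) (Some k) A - uzz (Some k) (Some k) B) <= - (2 * m).
  have [p1 +] := Ds 1; have [p2 _] := Ds (- 1); rewrite expr1n !mul1r.
  have -> : b * (uz (Some k) A + uz (Some k) B) - m / ka * (2 * L - 2 * s) = 0.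
    by move: p1 p2; rewrite mulN1r mul1r; lra.
  move=> /(_ erefl)/(ler_wpM2l (ltW ka0)); rewrite mulr0 mulrDr.
  by have -> : ka * (2 * (m / ka)) = 2 * m; [field; rewrite gt_eqF|lra].
(* At y = 0 a direction and its opposite are both admissible only when horizontal, hence [be = 0]
   there. *)
have Pxy i be : 0 < y \/ y = 0 /\ be = 0 ->
    uzz (Some i) (Some i) A - uzz (Some i) (Some i) B
    + 2 * (be * (uzz (Some i) None A - uzz (Some i) None B))
    + be ^+ 2 * (uzz None None A - uzz None None B) <= 2 * d * (1 + be ^+ 2).
  move=> ybe; have [|p1 p2] := Dz i 1 be.
    by case: ybe => [|[-> ->]]; [left|right].
  have [|p3 _] := Dz i (- 1) (- be).
    by case: ybe => [|[-> ->]]; [left|right; rewrite oppr0].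
  by move: p1 p2; rewrite !expr1n !mul1r => p1 p2; have : _ <= 0 := p2 _; lra.
(* On the boundary only the inward step is available, but D_y u = 0 already supplies the first-order
   equality. *)
have Yyy : (0 < y -> uz None A - uz None B = 2 * d * y) /\
    uzz None None A - uzz None None B <= 2 * d.
  have [|p1 p2] := Dz k 0 1.
    by move: y0; rewrite le_eqVlt => /predU1P[<-|]; [right|left].
  have Y1 : uz None A - uz None B = 2 * d * y.
    move: y0; rewrite le_eqVlt => /predU1P[y00|y00].
      by rewrite /A /B -y00 !(uz_boundary uJ) // subrr mulr0.
    by have [|p3 _] := Dz k 0 (- 1); [left|move: p1 p3; lra].
  by split=> //; move: p2; rewrite expr0n expr1n /= Y1 => p2; have : _ <= 0 := p2 _; lra.
have Kd : d * (2 * (N.+1%:R + c)) < d * K by rewrite ltr_pM2l.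
case: Yyy => Y1 Pyy; move: Dt1.
have [y1|y1] := boolP (0 < y); last first.
  have y00 : y = 0 by apply/eqP; rewrite eq_le y0 leNgt y1.
  have SP : \sum_(i < N) uzz (Some i) (Some i) A - \sum_(i < N) uzz (Some i) (Some i) B
      <= 2 * d * N%:R - 2 * m.
    rewrite -sumrB (bigD1 k) //=.
    have : \sum_(i < N | i != k) (uzz (Some i) (Some i) A - uzz (Some i) (Some i) B) <=
        \sum_(i < N | i != k) (2 * d).
      apply: ler_sum => i _; have := Pxy i 0 (or_intror (conj y00 erefl)).
      by rewrite expr0n /= !mul0r mulr0 !addr0 mulr1.
    have -> : \sum_(i < N | i != k) (2 * d) = 2 * d * N%:R - 2 * d.
      have : \sum_(i < N) (2 * d) = 2 * d * N%:R by rewrite sumr_const card_ord mulr_natr.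
      by rewrite (bigD1 k) //= => <-; rewrite [RHS]addrC addKr.
    have := Pxy k 0 (or_intror (conj y00 erefl)).
    rewrite expr0n /= !mul0r mulr0 !addr0 mulr1.
    (* Only the fraction [ka] of the second derivative in direction [k] is charged to the barrier,
       the rest to the penalization. *)
    have : (1 - ka) * (uzz (Some k) (Some k) A - uzz (Some k) (Some k) B) <=
      (1 - ka) * (2 * d).
      rewrite ler_wpM2l ?subr_ge0 ?(ltW ka1) //.
      by have := Pxy k 0 (or_intror (conj y00 erefl)); rewrite expr0n /= !mul0r; lra.
    have : 0 <= ka * d by rewrite mulr_ge0 ?ltW.
    by lra.
  have SY : (1 + c) * (uzz None None A - uzz None None B) <= (1 + c) * (2 * d).
    by rewrite ler_wpM2l // ltW.
  have -> : ut A = \sum_(i < N) uzz (Some i) (Some i) A + (1 + c) * uzz None None A.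
    by rewrite /A y00 (equation_boundary uJ).
  have -> : ut B = \sum_(i < N) uzz (Some i) (Some i) B + (1 + c) * uzz None None B.
    by rewrite /B y00 (equation_boundary uJ).
  move: Kd SP SY; rewrite -(addn1 N) natrD.
  by move: (\sum_(i < N) _) (\sum_(i < N) _) => *; lra.
rewrite (jet_interior uJ _ tT y1) (jet_interior uJ _ tT y1) -/A -/B.
have := weighted_quadratic_bound ka01 (ltW d0) a2 (fun i be => Pxy i be (or_introl y1)) Pyy Pkk.
rewrite /principal_part.
under [X in _ + 2 * X]eq_bigr do rewrite mulrBr.
rewrite !sumrB.
(* The first-order condition is an equality, so the singular term is exactly [2 d c], whatever the
   sign of [c]. *)
have : c / y * (uz None A - uz None B) = c * (2 * d).
  by rewrite (Y1 y1); field; rewrite gt_eqF.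
move: (c / y) => cy.
move: (\sum_(i < N) _) (\sum_(i < N) _) (\sum_(i < N) _) (\sum_(i < N) _) => *; lra.
Unshelve. all: by end_near. Qed.

Lemma doubled_x_continuous m ka d K t1 t0 L (A : set (R * ('rV[R]_N * (R * R)))) :
  (forall t x s y, A (t, (x, (s, y))) -> t <= T /\ 0 <= y) ->
  {within A, continuous (doubled_x m ka d K t1 t0 L)}.
Proof.
move=> AT; pose Q := (R * ('rV[R]_N * (R * R)))%type.
have ct : continuous (fun q : Q => q.1) by move=> q; exact: cvg_fst.
have c2 : continuous (fun q : Q => q.2) by move=> q; exact: cvg_snd.
have cx : continuous (fun q : Q => q.2.1).
  by move=> q; exact: (cvg_comp (fun q : Q => q.2) fst (c2 q) cvg_fst).
have c22 : continuous (fun q : Q => q.2.2).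
  by move=> q; exact: (cvg_comp (fun q : Q => q.2) snd (c2 q) cvg_snd).
have cs : continuous (fun q : Q => q.2.2.1).
  by move=> q; exact: (cvg_comp (fun q : Q => q.2.2) fst (c22 q) cvg_fst).
have cy : continuous (fun q : Q => q.2.2.2).
  by move=> q; exact: (cvg_comp (fun q : Q => q.2.2) snd (c22 q) cvg_snd).
have cu (e : R) : {within A, continuous (fun q : Q =>
    u (q.1, (q.2.1 + (q.2.2.1 * e) *: delta_mx 0 k, q.2.2.2)))}.
  apply: (@within_continuous_compose _ _ _ _ (@past R N T) (fun q : Q =>
    (q.1, (q.2.1 + (q.2.2.1 * e) *: delta_mx 0 k, q.2.2.2)))); last exact: (jet_continuous uJ).
  - move=> q; have H : (fun q : Q => q.2.1 + (q.2.2.1 * e) *: delta_mx 0 k) @ q -->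
        q.2.1 + (q.2.2.1 * e) *: delta_mx 0 k.
      by apply: cvgD; [exact: cx|apply: cvgZr_tmp; apply: cvgMr_tmp; exact: cs].
    exact: cvg_pair (ct q) (cvg_pair H (cy q)).
  - by move=> [t [x [s y]]] /AT; rewrite pastP.
have -> : doubled_x m ka d K t1 t0 L = fun q : Q =>
  u (q.1, (q.2.1 + (q.2.2.1 * b) *: delta_mx 0 k, q.2.2.2)) -
  u (q.1, (q.2.1 + (q.2.2.1 * - b) *: delta_mx 0 k, q.2.2.2)) -
  (m * (t1 - q.1) + m / ka * (q.2.2.1 * (2 * L - q.2.2.1)) +
   d * (\sum_(i < N) q.2.1 0 i ^+ 2 + q.2.2.2 ^+ 2 + K * (q.1 - t0))).
  by apply/funext => -[t [x [s y]]] /=; rewrite mulrN scaleNr !opprD !addrA.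
apply: within_continuousB; first exact: within_continuousB.
apply: continuous_subspaceT => q.
have cc (z : R) : z @[_ --> q] --> z by exact: cvg_cst.
apply: cvgD; first apply: cvgD.
- by apply: cvgM; [exact: cc|apply: cvgB; [exact: cc|exact: ct]].
- apply: cvgM; first exact: cc.
  by apply: cvgM; [exact: cs|apply: cvgB; [exact: cc|exact: cs]].
- apply: cvgM; first exact: cc.
  apply: cvgD; last by apply: cvgM; [exact: cc|apply: cvgB; [exact: ct|exact: cc]].
  apply: cvgD; last by apply: cvgM; exact: cy.
  have cxi i : (fun q : Q => q.2.1 0 i) @ q --> q.2.1 0 i.
    exact: (cvg_comp (fun q : Q => q.2.1) (fun x : 'rV[R]_N => x 0 i) (cx q)
      (@coord_continuous _ _ _ 0 i q.2.1)).
  by apply: cvg_sum_seq => i; apply: cvgM; exact: cxi.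
Qed.

(** Otherwise the doubled function would be positive at the given point. It is at most 0 on the
    faces t = t0, s = 0, s = L, |x_i| = r and y = r of a box, so its maximum admits all the
    variations of [doubled_x_no_max]; the faces t = t1 and y = 0 are harmless since only backward
    and inward steps are required there. *)
Lemma reflection_le (M t1 s1 y1 : R) (x1 : 'rV[R]_N) :
  0 < 1 + c -> \sum_(i < N) a 0 i ^+ 2 < 1 ->
  (forall p, @past R N T p -> `|u p| <= M) -> t1 <= T -> 0 < s1 -> 0 <= y1 ->
  u (t1, (x1 + (s1 * b) *: delta_mx 0 k, y1)) <=
  u (t1, (x1 - (s1 * b) *: delta_mx 0 k, y1)).
Proof.
move=> c1 a1 uM tT s0 y0; rewrite -subr_le0 leNgt; apply/negP; set v := _ - _ => v0.
have M0 : 0 <= M.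
  by apply: (le_trans _ (uM (t1, (x1, y1)) _)) => //; apply/pastP.
have sqr_sum x i : x 0 i ^+ 2 <= \sum_(i < N) x 0 i ^+ 2 :> R.
  by rewrite (bigD1 i) //= lerDl sumr_ge0 // => j _; exact: sqr_ge0.
have [ka [ka0 ka1 a2]] : exists ka, [/\ 0 < ka, ka < 1 &
    \sum_(i < N) a 0 i ^+ 2 = 1 - 2 * ka].
  have : 0 <= \sum_(i < N) a 0 i ^+ 2 by apply: sumr_ge0 => i _; exact: sqr_ge0.
  by exists ((1 - \sum_(i < N) a 0 i ^+ 2) / 2); split; lra.
(* [L] is so large that the barrier at [s1], at most [4 M s1 / (ka L)], stays below [v / 2]; the
   penalization gets the other half through [d]. *)
have [L sL nL] : exists2 L, s1 < L & 8 * M * s1 < L * (ka * v).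
  by apply: exists_large; rewrite ?mulr_ge0 ?mulr_gt0 // ltW.
have L0 : 0 < L by exact: lt_trans sL.
have [m m0 mL] : exists2 m, 0 <= m & m * L ^+ 2 = 2 * M.
  exists (2 * M / L ^+ 2); first by rewrite divr_ge0 ?sqr_ge0 // mulr_ge0.
  by rewrite divfK // expf_neq0 ?gt_eqF.
have mka0 : 0 <= m / ka by apply: divr_ge0 => //; exact: ltW.
have ms1 : m / ka * (s1 * (2 * L - s1)) < v / 2.
  apply: (@le_lt_trans _ _ (m / ka * (s1 * (2 * L)))).
    by rewrite ler_wpM2l // ler_wpM2l ?(ltW s0) // gerBl ltW.
  have -> : m / ka * (s1 * (2 * L)) = 4 * M * s1 / (ka * L).
    have -> : m = 2 * M / L ^+ 2 by rewrite -mL mulfK // expf_neq0 ?gt_eqF.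
    by field; rewrite !gt_eqF.
  by rewrite ltr_pdivrMr ?mulr_gt0 //; move: nL; lra.
have [K K0 Kc] : exists2 K, 0 < K & 2 * (N.+1%:R + c) < K.
  have N1 : (1 : R) <= N.+1%:R by rewrite ler1n.
  by exists (2 * (N.+1%:R + c) + 1); lra.
pose X : R := \sum_(i < N) x1 0 i ^+ 2.
have X0 : 0 <= X by apply: sumr_ge0 => i _; exact: sqr_ge0.
have [d d0 dG] : exists2 d, 0 < d & d * (X + y1 ^+ 2 + K * L ^+ 2) < v / 2.
  apply: exists_small; last by rewrite divr_gt0.
  by rewrite !addr_ge0 ?sqr_ge0 // mulr_ge0 ?sqr_ge0 // ltW.
have M20 : 0 <= 2 * M by exact: mulr_ge0.
(* At radius [r] the penalization reaches [2 M], a bound for all differences of values of u; the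
   lower bound on [r] keeps the given point in the box. *)
have [r [r0 dr Xr]] := exists_radius (1 + X + y1 ^+ 2) M20 d0.
pose t0 : R := t1 - L ^+ 2.
have t10 : t0 <= t1 by rewrite lerBlDr lerDl sqr_ge0.
pose w := doubled_x m ka d K t1 t0 L.
pose Box : set (R * ('rV[R]_N * (R * R))) := `[t0, t1] `*`
  ([set x : 'rV[R]_N | forall i, `[- r, r]%classic (x ord0 i)] `*` (`[0, L] `*` `[0, r])).
have BoxP t x s y : Box (t, (x, (s, y))) <-> [/\ t0 <= t <= t1,
    forall i, - r <= x 0 i <= r, 0 <= s <= L & 0 <= y <= r].
  rewrite /Box /setX /= !in_itv /=; split.
    by move=> [? [H [? ?]]]; split=> // i; have := H i; rewrite /= in_itv.
  by move=> [? H ? ?]; split=> //; split=> // i; rewrite /= in_itv.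
have cBox : compact Box.
  apply: compact_setX; first exact: segment_compact.
  apply: compact_setX; last by apply: compact_setX; exact: segment_compact.
  by apply: (@rV_compact R N (fun _ => `[- r, r]%classic)) => i; exact: segment_compact.
have Box1 : Box (t1, (x1, (s1, y1))).
  apply/BoxP; split; first by rewrite lexx andbT.
  - move=> i; rewrite -ler_norml (le_trans (norm_le_sqr _)) // (le_trans _ Xr) //.
    by rewrite -addrA lerD2l ler_wpDr ?sqr_ge0 // sqr_sum.
  - by rewrite !ltW.
  - rewrite y0 (le_trans (ler_norm y1)) // (le_trans (norm_le_sqr _)) //.
    by rewrite (le_trans _ Xr) // lerD2r lerDl.
have cw : {within Box, continuous w}.
  apply: doubled_x_continuous => t x s y /BoxP[/andP[_ tt] _ _ /andP[yy _]].
  by split=> //; exact: le_trans tT.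
have [[t [x [s y]]] pBox pmax] := compact_EVT_max (ex_intro _ _ Box1) cBox cw.
have {}pmax q : Box q -> w q <= w (t, (x, (s, y))).
  by move=> Bq; apply: pmax; rewrite inE.
move: pBox; rewrite inE => /BoxP[/andP[tt0 tt1] xr /andP[ss0 sL1] /andP[yy0 yr]].
have w0 : 0 < w (t, (x, (s, y))).
  apply: lt_le_trans (pmax _ Box1); rewrite /w /doubled_x -/v -/X subrr mulr0 subr0.
  have -> : X + y1 ^+ 2 + K * (t1 - t0) = X + y1 ^+ 2 + K * L ^+ 2 by rewrite /t0; ring.
  by move: ms1 dG; lra.
have tT' : t <= T by exact: le_trans tT.
pose A : spacetime R N := (t, (x + (s * b) *: delta_mx 0 k, y)).
pose B : spacetime R N := (t, (x - (s * b) *: delta_mx 0 k, y)).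
have uAB : u A - u B <= 2 * M.
  have : `|u A| <= M by apply: uM; rewrite pastP.
  have : `|u B| <= M by apply: uM; rewrite pastP.
  by rewrite !ler_norml; lra.
have b0 : 0 <= m * (t1 - t) by rewrite mulr_ge0 // subr_ge0.
have s2L : 0 <= s * (2 * L - s).
  by rewrite mulr_ge0 // subr_ge0 (le_trans sL1) // mulrDl mul1r lerDl ltW.
have bs : 0 <= m / ka * (s * (2 * L - s)) by exact: mulr_ge0.
have bx : 0 <= d * (\sum_(i < N) x 0 i ^+ 2).
  by rewrite mulr_ge0 ?(ltW d0) // sumr_ge0 // => i _; exact: sqr_ge0.
have by0 : 0 <= d * y ^+ 2 by rewrite mulr_ge0 ?sqr_ge0 // ltW.
have bK : 0 <= d * (K * (t - t0)).
  by rewrite (mulr_ge0 (ltW d0)) // (mulr_ge0 (ltW K0)) // subr_ge0.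
have {}w0 : m * (t1 - t) + m / ka * (s * (2 * L - s)) + d * (\sum_(i < N) x 0 i ^+ 2)
    + d * y ^+ 2 + d * (K * (t - t0)) < u A - u B.
  by move: w0; rewrite /w /doubled_x -/A -/B !(mulrDr d); lra.
have large (z : R) : r <= `|z| -> 2 * M <= d * z ^+ 2.
  move=> rz; apply: (le_trans dr); rewrite ler_pM2l // -(real_normK (num_real z)).
  by rewrite ler_sqr ?nnegrE ?(ltW r0).
(* The faces are excluded one by one: at t0 the time term equals [m L^2 = 2 M], at s = 0 the two
   points coincide, at s = L the barrier is [2 M / ka >= 2 M], and at radius [r] the penalization
   takes over. *)
have t0t : t0 < t.
  rewrite lt_neqAle tt0 andbT; apply/eqP => E.
  have : m * (t1 - t) = 2 * M by rewrite -mL -E /t0; ring.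
  by move: w0 uAB bs bx by0 bK; clear; lra.
have s00 : 0 < s.
  rewrite lt_neqAle ss0 andbT; apply/eqP => E; move: w0.
  have -> : A = B by rewrite /A /B -E mul0r scale0r subr0 addr0.
  by rewrite subrr; move: b0 bs bx by0 bK; lra.
have sL' : s < L.
  rewrite lt_neqAle sL1 andbT; apply/eqP => E.
  have : 2 * M <= m / ka * (s * (2 * L - s)).
    have -> : m / ka * (s * (2 * L - s)) = 2 * M / ka.
      by rewrite E -mL; field; rewrite gt_eqF.
    by rewrite ler_pdivlMr // ler_piMr // ltW.
  by move: w0 uAB b0 bx by0 bK; clear; lra.
have xr' i : - r < x 0 i < r.
  rewrite -ltr_norml ltNge; apply/negP => /large.
  have : d * x 0 i ^+ 2 <= d * (\sum_(i < N) x 0 i ^+ 2) by rewrite ler_pM2l // sqr_sum.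
  by move: w0 uAB b0 bs by0 bK; clear; lra.
have yr' : y < r.
  rewrite -(ger0_norm yy0) ltNge; apply/negP => /large.
  by move: w0 uAB b0 bs bx bK; clear; lra.
apply: (@doubled_x_no_max m ka d K t1 t0 L t s y x) => //; first by rewrite ka0.
- near=> h; apply: (pmax (t - h, (x, (s, y)))); apply/BoxP; split.
  + apply/andP; split; last by rewrite lerBlDr (le_trans tt1) // lerDl ltW.
    have : t0 <= t + h * (- 1) by near: h; exact: near_right_affine_ge.
    by rewrite mulrN1.
  + by [].
  + by rewrite ss0.
  + by rewrite yy0.
- move=> i al be ybe; have [ry ry0 ryP] := motion_in_half_space ybe.
  have /andP[xr1 xr2] := xr' i.
  near=> h; have h0 : 0 < h by [].
  apply: (pmax (t, (x + (h * al) *: delta_mx 0 i, (s, y + h * be)))); apply/BoxP; split.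
  + by rewrite tt0.
  + move=> j; rewrite !mxE eqxx /=; have [->|_] := eqVneq j i; last by rewrite mulr0 addr0.
    rewrite mulr1; apply/andP; split; near: h.
      exact: near_right_affine_ge.
    exact: near_right_affine_le.
  + by rewrite ss0.
  + rewrite ryP /=; last by rewrite (ltW h0) /=; near: h; exact: nbhs_right_le.
    by near: h; exact: near_right_affine_le.
- move=> si; near=> h; apply: (pmax (t, (x, (s + h * si, y)))); apply/BoxP; split.
  + by rewrite tt0.
  + by [].
  + apply/andP; split; near: h.
      exact: near_right_affine_ge.
    exact: near_right_affine_le.
  + by rewrite yy0.
Unshelve. all: by end_near. Qed.

End independence_of_x.

(** * Independence of y *)

Section independence_of_y.
Context {R : realType} {N : nat} {c : R} {a : 'rV[R]_N} {T : R}
  {u ut : spacetime R N -> R} {uz : option 'I_N -> spacetime R N -> R}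
  {uzz : option 'I_N -> option 'I_N -> spacetime R N -> R}.
Implicit Types (t y z h : R) (x : 'rV[R]_N) (i : 'I_N).
Hypothesis uJ : solution_jet c a T u ut uz uzz.
Hypothesis ux : forall t x y, t <= T -> 0 <= y -> u (t, (x, y)) = u (t, (0, y)).

Lemma shift_x t x y h i :
  (t, (x, y) : 'rV[R]_N * R) + h *: dir_z (Some i) = (t, (x + h *: delta_mx 0 i, y)).
Proof.
by apply: injective_projections => /=; [|apply: injective_projections => /=];
  rewrite ?scaler0 ?addr0.
Qed.

Lemma uz_x_eq0 i t x y : t <= T -> 0 <= y -> uz (Some i) (t, (x, y)) = 0.
Proof.
move=> tT y0; have Dp : past T (t, (x, y)) by rewrite pastP.
apply: (has_derivative_within_cst (jet_derivative_z uJ (Some i) Dp)) => h h0.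
by rewrite shift_x !pastP !(@ux t _ y).
Qed.

Lemma uzz_xx_eq0 i t x y : t <= T -> 0 <= y -> uzz (Some i) (Some i) (t, (x, y)) = 0.
Proof.
move=> tT y0; have Dp : past T (t, (x, y)) by rewrite pastP.
apply: (has_derivative_within_cst (jet_derivative_zz uJ (Some i) (Some i) Dp)) => h h0.
by rewrite shift_x !pastP !uz_x_eq0.
Qed.

Lemma uz_y_eq t x y : t <= T -> 0 <= y -> uz None (t, (x, y)) = uz None (t, (0, y)).
Proof.
move=> tT y0; have Dp (x' : 'rV[R]_N) : past T (t, (x', y)) by rewrite pastP.
apply: (has_derivative_within_unique (jet_derivative_z uJ None (Dp x))
  (jet_derivative_z uJ None (Dp 0))) => h h0.
have E (x' : 'rV[R]_N) : (t, (x', y)) + h *: dir_z None = (t, (x', y + h)) :> spacetime R N.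
  by apply: injective_projections => /=; [|apply: injective_projections => /=];
    rewrite ?scaler0 ?addr0 ?add0r //; congr (_ + _); exact: mulr1.
have yh : 0 <= y + h by rewrite addr_ge0 // ltW.
by rewrite !E (ux x tT yh) (ux x tT y0); split=> //; apply/pastP.
Qed.

Lemma uzz_xy_eq0 i t x y : t <= T -> 0 <= y -> uzz (Some i) None (t, (x, y)) = 0.
Proof.
move=> tT y0; have Dp : past T (t, (x, y)) by rewrite pastP.
apply: (has_derivative_within_cst (jet_derivative_zz uJ (Some i) None Dp)) => h h0.
by rewrite shift_x !pastP !(uz_y_eq _ tT y0).
Qed.

Lemma radial_interior t y : t <= T -> 0 < y ->
  ut (t, (0, y)) = uzz None None (t, (0, y)) + c / y * uz None (t, (0, y)).
Proof.
move=> tT y0; rewrite (jet_interior uJ _ tT y0) /principal_part.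
under eq_bigr do rewrite uzz_xx_eq0 ?(ltW y0) //.
under [X in 2 * X]eq_bigr do rewrite uzz_xy_eq0 ?(ltW y0) // mulr0.
by rewrite !big1_eq mulr0 !add0r.
Qed.

Lemma radial_boundary t : t <= T -> ut (t, (0, 0)) = (1 + c) * uzz None None (t, (0, 0)).
Proof.
move=> tT; rewrite (equation_boundary uJ) //.
by under eq_bigr do rewrite uzz_xx_eq0 //; rewrite big1_eq add0r.
Qed.

Variable b : R.
Hypothesis b2 : b ^+ 2 = 1.

(* The barrier described at the top of the file is obtained for [n = 2 M / L] and [m = n / L]. *)
Definition doubled_y (m n d K t1 t0 : R) (t y z : R) : R :=
  b * u (t, (0, y)) - b * u (t, (0, z)) - m * (t1 - t)
  - n * Num.sqrt (y ^+ 2 - z ^+ 2) - d * (y ^+ 2 + z ^+ 2 + K * (t - t0)).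

(** With [r = sqrt (y^2 - z^2)], the first-order conditions turn the barrier part of both singular
    terms into [c n / r], which cancels and leaves [4 d c]. The second-order terms add up to at most
    [4 d - n (y^2 + z^2) / r^3 <= 4 d - n / r]. Hence [d K - m <= 4 d (1 + c) - n / r <= 4 d (1 + c)
    - m], against the choice of [K]. *)
Lemma doubled_y_no_max (m n d K t1 t0 t y z : R) :
  0 < 1 + c -> 0 <= n -> m * Num.sqrt (y ^+ 2 - z ^+ 2) <= n -> 0 < d ->
  4 * (1 + c) < K -> t <= T -> 0 <= z < y ->
  let w := doubled_y m n d K t1 t0 in
  (\forall h \near 0^'+, w (t - h) y z <= w t y z) ->
  (forall si, \forall h \near 0^'+, w t (y + h * si) z <= w t y z) ->
  (forall si, 0 < z \/ z = 0 /\ 0 <= si ->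
    \forall h \near 0^'+, w t y (z + h * si) <= w t y z) ->
  False.
Proof.
move=> c1 n0 mn d0 KN tT /andP[z0 zy] w maxt maxy maxz.
have y0 : 0 < y by exact: le_lt_trans zy.
pose A : spacetime R N := (t, (0, y)); pose B : spacetime R N := (t, (0, z)).
pose s := y ^+ 2 - z ^+ 2.
have s0 : 0 < s by rewrite subr_gt0 ltr_sqr ?nnegrE // ltW.
have [r0 rs] : 0 < Num.sqrt s /\ Num.sqrt s ^+ 2 = s.
  by rewrite sqrtr_gt0 sqr_sqrtr // ltW.
move: mn; rewrite -/s => mn.
have Dt1 : d * K - m <= b * ut A - b * ut B.
  apply/ler_addgt0Pr => e e0; have e20 : 0 < e / 2 by rewrite divr_gt0.
  have [h [h0 []]] : exists h, 0 < h /\ (w (t - h) y z <= w t y z /\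
    (`|u (t - h, A.2) - u A + h * ut A| <= e / 2 * h /\
     `|u (t - h, B.2) - u B + h * ut B| <= e / 2 * h)).
    near (0 : R)^'+ => h; exists h; split => //; split; first by near: h.
    by split; near: h; apply: (expansion_u_t uJ) => //; exact: ltW.
  rewrite /w /doubled_y /= -[(t, (0, y))]/A -[(t, (0, z))]/B => w1 [HA HB].
  have b1 : `|b| = 1 by apply/eqP; rewrite -sqrp_eq1 // real_normK ?num_real // b2.
  have : `|b * (u (t - h, (0, y)) - u A + h * ut A)| <= e / 2 * h by rewrite normrM b1 mul1r.
  have : `|b * (u (t - h, (0, z)) - u B + h * ut B)| <= e / 2 * h by rewrite normrM b1 mul1r.
  rewrite !ler_norml.
  move: (u A) (u B) (ut A) (ut B) (u (t - h, (0, y))) (u (t - h, (0, z))) w1.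
  by move=> *; rewrite -(ler_pM2l h0); lra.
pose W0 := - m * (t1 - t) - d * (y ^+ 2 + z ^+ 2 + K * (t - t0)).
have Dy1 si : si * (b * uz None A) - n * (y * si / Num.sqrt s) - 2 * d * y * si <= 0 /\
    (si * (b * uz None A) - n * (y * si / Num.sqrt s) - 2 * d * y * si = 0 ->
    si ^+ 2 * (b * uzz None None A) + n * (si ^+ 2 * y ^+ 2 / Num.sqrt s ^+ 3
      - si ^+ 2 / Num.sqrt s) - 2 * d * si ^+ 2 <= 0).
  have EA := lower_expansionZ b (fun e (e0 : 0 < e) => @expansion_u_y _ _ _ _ _ _ _ _ _ uJ
    si t 0 y e tT e0 (or_introl y0)).
  have ES := lower_expansion_pZ n0 (lower_expansion_sqrt (2 * y * si) (si ^+ 2) s0).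
  have EQ := lower_expansion_quad (- (b * u B) + W0) (- d * (2 * y * si)) (- d * si ^+ 2).
  have [|H1 H2] := lower_expansion_max (lower_expansionD (lower_expansionD EA ES) EQ).
    apply: filterS (maxy si) => h; rewrite /w /doubled_y -/s -/A -/B.
    have -> : (y + h * si) ^+ 2 - z ^+ 2 = s + 2 * y * si * h + si ^+ 2 * h ^+ 2.
      by rewrite /s; ring.
    rewrite /W0; move: (Num.sqrt _) (Num.sqrt _) (u _) (u _) (u _) => *; lra.
  move: H1 H2; rewrite -/A; move: (uz None A) (uzz None None A) => UA UAA.
  move: (Num.sqrt s) r0 => r r0'.
  have -> : 2 * y * si / (2 * r) = y * si / r by field; rewrite gt_eqF.
  have -> : (2 * y * si) ^+ 2 / (4 * r ^+ 3) = si ^+ 2 * y ^+ 2 / r ^+ 3.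
    by field; rewrite gt_eqF.
  move: (y * si / r) (si ^+ 2 * y ^+ 2 / r ^+ 3) (si ^+ 2 / r) => P Q S H1 H2.
  split; first by move: H1; lra.
  by move=> E; have : _ <= 0 := H2 _; lra.
have Dz1 si : 0 < z \/ z = 0 /\ 0 <= si ->
    - si * (b * uz None B) + n * (z * si / Num.sqrt s) - 2 * d * z * si <= 0 /\
    (- si * (b * uz None B) + n * (z * si / Num.sqrt s) - 2 * d * z * si = 0 ->
    - si ^+ 2 * (b * uzz None None B) + n * (si ^+ 2 * z ^+ 2 / Num.sqrt s ^+ 3
      + si ^+ 2 / Num.sqrt s) - 2 * d * si ^+ 2 <= 0).
  move=> zsi.
  have EB := lower_expansionZ (- b) (fun e (e0 : 0 < e) => @expansion_u_y _ _ _ _ _ _ _ _ _ uJ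
    si t 0 z e tT e0 zsi).
  have ES := lower_expansion_pZ n0 (lower_expansion_sqrt (- (2 * z * si)) (- si ^+ 2) s0).
  have EQ := lower_expansion_quad (b * u A + W0) (- d * (2 * z * si)) (- d * si ^+ 2).
  have [|H1 H2] := lower_expansion_max (lower_expansionD (lower_expansionD EB ES) EQ).
    apply: filterS (maxz si zsi) => h; rewrite /w /doubled_y -/s -/A -/B.
    have -> : y ^+ 2 - (z + h * si) ^+ 2 = s + - (2 * z * si) * h + - si ^+ 2 * h ^+ 2.
      by rewrite /s; ring.
    rewrite /W0; move: (Num.sqrt _) (Num.sqrt _) (u _) (u _) (u _) => *; lra.
  move: H1 H2; rewrite -/B; move: (uz None B) (uzz None None B) => UB UBB.
  move: (Num.sqrt s) r0 => r r0'.
  have -> : - (2 * z * si) / (2 * r) = - (z * si / r) by field; rewrite gt_eqF.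
  have -> : (- (2 * z * si)) ^+ 2 / (4 * r ^+ 3) = si ^+ 2 * z ^+ 2 / r ^+ 3.
    by field; rewrite gt_eqF.
  rewrite (mulNr (si ^+ 2) r^-1); move: (z * si / r) (si ^+ 2 * z ^+ 2 / r ^+ 3) (si ^+ 2 / r) => P Q S H1 H2.
  split; first by move: H1; lra.
  by move=> E; have : _ <= 0 := H2 _; lra.
set r := Num.sqrt s in r0 rs mn Dy1 Dz1.
have rn0 : r != 0 by rewrite gt_eqF.
have UA : b * uz None A = n * (y / r) + 2 * d * y.
  have nr e : n * (y * e / r) = n * (y / r) * e by field.
  have [p1 _] := Dy1 1; have [p2 _] := Dy1 (- 1); move: p1 p2; rewrite !nr; lra.
have UAA : b * uzz None None A <= 2 * d + n / r - n * (y ^+ 2 / r ^+ 3).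
  have [_ p2] := Dy1 1; move: p2; rewrite expr1n !mul1r !mulr1 UA => p2.
  have : _ <= 0 := p2 _; lra.
have UB : b * uz None B = n * (z / r) - 2 * d * z.
  move: z0; rewrite le_eqVlt => /predU1P[z00|z1].
    by rewrite /B -z00 (uz_boundary uJ) // mul0r !mulr0 subrr.
  have nr e : n * (z * e / r) = n * (z / r) * e by field.
  have [p1 _] := Dz1 1 (or_introl z1); have [p2 _] := Dz1 (- 1) (or_introl z1).
  by move: p1 p2; rewrite !nr; lra.
have UBB : - (b * uzz None None B) <= 2 * d - n / r - n * (z ^+ 2 / r ^+ 3).
  have [|_ p2] := Dz1 1; first by move: z0; rewrite le_eqVlt => /predU1P[<-|]; [right|left].
  move: p2; rewrite expr1n mulN1r !mul1r !mulr1 UB => p2.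
  by have : _ <= 0 := p2 _; lra.
have nm : m <= n / r by rewrite ler_pdivlMr.
have Kd : d * (4 * (1 + c)) < d * K by rewrite ltr_pM2l.
have yzr : y ^+ 2 - z ^+ 2 = r ^+ 2 by rewrite rs.
move: Dt1; rewrite (radial_interior tT y0) -/A mulrDr (mulrCA b) UA.
have -> : c / y * (n * (y / r) + 2 * d * y) = c * (n / r) + c * (2 * d).
  by field; rewrite rn0 gt_eqF.
(* For z = 0 one has [r = y], and the boundary form of the equation replaces the singular term at
   [B] by the factor [1 + c], whose positivity preserves the bound on D_yy u. *)
have [z00|z1] := eqVneq z 0.
  move: UAA UBB; have -> : n * (y ^+ 2 / r ^+ 3) = n / r.
    by move: yzr; rewrite z00 expr0n /= subr0 => ->; field.
  rewrite /B z00 expr0n /= !mul0r mulr0 subr0 (radial_boundary tT) (mulrCA b) => UAA.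
  move=> /(ler_wpM2l (ltW c1)).
  by move: (b * uzz _ _ A) (b * uzz _ _ (t, (0, 0))) (n / r) UAA nm => *; lra.
rewrite (radial_interior tT) ?lt_def ?z1 // -/B mulrDr (mulrCA b) UB.
have -> : c / z * (n * (z / r) - 2 * d * z) = c * (n / r) - c * (2 * d).
  by field; rewrite rn0 z1.
(* This is [y^2 + z^2 >= y^2 - z^2 = r^2], multiplied by [n / r^3]. *)
have : n / r <= n * (y ^+ 2 / r ^+ 3) + n * (z ^+ 2 / r ^+ 3).
  have -> : n * (y ^+ 2 / r ^+ 3) + n * (z ^+ 2 / r ^+ 3) =
      n / r + n * (2 * z ^+ 2 / r ^+ 3).
    have -> : y ^+ 2 = r ^+ 2 + z ^+ 2 by rewrite -yzr subrK.
    by field.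
  by rewrite lerDl !mulr_ge0 ?sqr_ge0 // invr_ge0 exprn_ge0 // ltW.
move: (n * (y ^+ 2 / r ^+ 3)) (n * (z ^+ 2 / r ^+ 3)) (n / r) UAA UBB nm.
move: (b * uzz _ _ A) (b * uzz _ _ B) => *; lra.
Unshelve. all: by end_near. Qed.

(** The coordinates are (t, g, z) with the gap g = y - z, which turn the region 0 <= z <= y into a
    product of intervals. *)
Lemma doubled_y_continuous (m n d K t1 t0 : R) (A : set (R * (R * R))) :
  (forall t g z, A (t, (g, z)) -> [/\ t <= T, 0 <= g & 0 <= z]) ->
  {within A, continuous (fun q => doubled_y m n d K t1 t0 q.1 (q.2.2 + q.2.1) q.2.2)}.
Proof.
move=> AT; pose Q := (R * (R * R))%type.
have ct : continuous (fun q : Q => q.1) by move=> q; exact: cvg_fst.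
have c2 : continuous (fun q : Q => q.2) by move=> q; exact: cvg_snd.
have cg : continuous (fun q : Q => q.2.1).
  by move=> q; exact: (cvg_comp (fun q : Q => q.2) fst (c2 q) cvg_fst).
have cz : continuous (fun q : Q => q.2.2).
  by move=> q; exact: (cvg_comp (fun q : Q => q.2) snd (c2 q) cvg_snd).
have cy : continuous (fun q : Q => q.2.2 + q.2.1).
  by move=> q; apply: cvgD; [exact: cz|exact: cg].
have cu (f : Q -> R) : continuous f -> (forall q, A q -> 0 <= f q) ->
    {within A, continuous (fun q : Q => b * u (q.1, (0, f q)))}.
  move=> cf f0 q; apply: cvgMl_tmp; move: q.
  apply: (@within_continuous_compose _ _ _ _ (@past R N T) (fun q : Q => (q.1, (0, f q))));
    last exact: (jet_continuous uJ).
  - by move=> q; exact: cvg_pair (ct q) (cvg_pair (cvg_cst (0 : 'rV[R]_N)) (cf q)).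
  - by move=> [t [g z]] Aq; apply/pastP; split; [case: (AT _ _ _ Aq)|exact: (f0 _ Aq)].
have -> : (fun q : Q => doubled_y m n d K t1 t0 q.1 (q.2.2 + q.2.1) q.2.2) = fun q : Q =>
  b * u (q.1, (0, q.2.2 + q.2.1)) - b * u (q.1, (0, q.2.2)) -
  (m * (t1 - q.1) + n * Num.sqrt ((q.2.2 + q.2.1) ^+ 2 - q.2.2 ^+ 2) +
   d * ((q.2.2 + q.2.1) ^+ 2 + q.2.2 ^+ 2 + K * (q.1 - t0))).
  by apply/funext => q; rewrite /doubled_y !opprD !addrA.
apply: within_continuousB.
  apply: within_continuousB.
    by apply: (cu _ cy) => -[t [g z]] /AT[_ g0 z0]; exact: addr_ge0.
  by apply: (cu _ cz) => -[t [g z]] /AT[].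
apply: continuous_subspaceT => q.
have cc (x : R) : x @[_ --> q] --> x by exact: cvg_cst.
have cy2 : (fun q : Q => (q.2.2 + q.2.1) ^+ 2) @ q --> (q.2.2 + q.2.1) ^+ 2.
  by apply: cvgM; exact: cy.
have cz2 : (fun q : Q => q.2.2 ^+ 2) @ q --> q.2.2 ^+ 2 by apply: cvgM; exact: cz.
apply: cvgD; first apply: cvgD.
- by apply: cvgM; [exact: cc|apply: cvgB; [exact: cc|exact: ct]].
- apply: cvgM; first exact: cc.
  exact: (cvg_comp (fun q : Q => (q.2.2 + q.2.1) ^+ 2 - q.2.2 ^+ 2) Num.sqrt
    (cvgB cy2 cz2) (@sqrt_continuous _ _)).
- apply: cvgM; first exact: cc.
  apply: cvgD; last by apply: cvgM; [exact: cc|apply: cvgB; [exact: ct|exact: cc]].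
  exact: cvgD cy2 cz2.
Qed.

(** A positive [v] would make the doubled function positive at the given point, while it is at most
    0 at time t1 - L^2, on the diagonal g = 0, and where y or z is at least [r]. The maximum thus
    avoids the diagonal, where the root is not differentiable. *)
Lemma radial_le (M t1 y1 z1 : R) : 0 < 1 + c ->
  (forall p, @past R N T p -> `|u p| <= M) -> t1 <= T -> 0 <= z1 < y1 ->
  b * u (t1, (0, y1)) <= b * u (t1, (0, z1)).
Proof.
move=> c1 uM tT /andP[z10 zy1]; rewrite -subr_le0 leNgt; apply/negP; set v := _ - _ => v0.
have y10 : 0 < y1 by exact: le_lt_trans zy1.
have M0 : 0 <= M.
  by apply: le_trans (uM (t1, (0, y1)) _) => //; apply/pastP; split=> //; exact: ltW.
have bu t y z : t <= T -> 0 <= y -> 0 <= z -> b * u (t, (0, y)) - b * u (t, (0, z)) <= 2 * M.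
  move=> tT' y0 z0; have b1 : `|b| = 1 by apply/eqP; rewrite -sqrp_eq1 // real_normK ?num_real // b2.
  have : `|b * u (t, (0, y))| <= M by rewrite normrM b1 mul1r uM //; apply/pastP.
  have : `|b * u (t, (0, z))| <= M by rewrite normrM b1 mul1r uM //; apply/pastP.
  by rewrite !ler_norml; lra.
pose r1 : R := Num.sqrt (y1 ^+ 2 - z1 ^+ 2).
(* This makes the root term at the given point, [2 M r1 / L], smaller than [v / 2]. *)
have [L L0 nL] : exists2 L, 0 < L & 4 * M * r1 < L * v.
  by apply: exists_large => //; rewrite !mulr_ge0 // sqrtr_ge0.
have [n n0 nLM] : exists2 n, 0 <= n & n * L = 2 * M.
  exists (2 * M / L); first by apply: divr_ge0; [exact: mulr_ge0|exact: ltW].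
  by rewrite divfK ?gt_eqF.
have nr1 : n * r1 < v / 2.
  by rewrite -(ltr_pM2r L0) mulrAC nLM; lra.
have [m m0 mL] : exists2 m, 0 <= m & m * L = n.
  by exists (n / L); [exact: divr_ge0 n0 (ltW L0)|rewrite divfK ?gt_eqF].
have [K K0 Kc] : exists2 K, 0 < K & 4 * (1 + c) < K by exists (4 * (1 + c) + 1); lra.
have KL : 0 <= K * L ^+ 2 by rewrite mulr_ge0 ?sqr_ge0 // ltW.
have [d d0 dG] : exists2 d, 0 < d & d * (y1 ^+ 2 + z1 ^+ 2 + K * L ^+ 2) < v / 2.
  by apply: exists_small; [rewrite !addr_ge0 ?sqr_ge0|rewrite divr_gt0].
have M20 : 0 <= 2 * M by exact: mulr_ge0.
have [r [r0 dr yr]] := exists_radius y1 M20 d0.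
pose w := doubled_y m n d K t1 (t1 - L ^+ 2).
pose Box : set (R * (R * R)) := `[t1 - L ^+ 2, t1] `*` (`[0, r] `*` `[0, r]).
have BoxP t g z : Box (t, (g, z)) <->
    [/\ t1 - L ^+ 2 <= t <= t1, 0 <= g <= r & 0 <= z <= r].
  by rewrite /Box /setX /= !in_itv /=; split=> [[? []]|[]].
have cBox : compact Box.
  apply: compact_setX; first exact: segment_compact.
  by apply: compact_setX; exact: segment_compact.
have L20 : 0 <= L ^+ 2 by exact: sqr_ge0.
have Box1 : Box (t1, (y1 - z1, z1)).
  apply/BoxP; split; last by rewrite z10 (le_trans (ltW zy1)).
    by rewrite lexx andbT lerBlDr lerDl.
  by rewrite subr_ge0 (ltW zy1) (le_trans _ yr) // lerBlDr lerDl.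
have cw : {within Box, continuous (fun q => w q.1 (q.2.2 + q.2.1) q.2.2)}.
  apply: doubled_y_continuous => t g z /BoxP[/andP[_ tt] /andP[gg _] /andP[zz _]].
  by split=> //; exact: le_trans tT.
have [[t [g z]] pBox pmax] := compact_EVT_max (ex_intro _ _ Box1) cBox cw.
move: pBox; rewrite inE => /BoxP[/andP[tt0 tt1] /andP[g0 gr] /andP[zz0 zr]].
pose y : R := z + g.
have {}pmax t' y' z' : t1 - L ^+ 2 <= t' <= t1 -> 0 <= y' - z' <= r -> 0 <= z' <= r ->
    w t' y' z' <= w t y z.
  move=> h1 h2 h3; have := pmax (t', (y' - z', z')); rewrite /= (addrC z') subrK; apply.
  by rewrite inE; apply/BoxP.
have w0 : 0 < w t y z.
  have := pmax t1 y1 z1; move/BoxP: Box1 => [h1 h2 h3] /(_ h1 h2 h3); apply: lt_le_trans.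
  rewrite /w /doubled_y -/v -/r1 subrr mulr0 subr0.
  have -> : y1 ^+ 2 + z1 ^+ 2 + K * (t1 - (t1 - L ^+ 2)) = y1 ^+ 2 + z1 ^+ 2 + K * L ^+ 2.
    by ring.
  by move: nr1 dG; clear; lra.
clear dG nr1 Box1 cw cBox BoxP nL yr.
have tT' : t <= T by exact: le_trans tT.
have y0 : 0 <= y by rewrite addr_ge0.
have uAB := bu t y z tT' y0 zz0.
have b0 : 0 <= m * (t1 - t) by rewrite mulr_ge0 // subr_ge0.
have bn : 0 <= n * Num.sqrt (y ^+ 2 - z ^+ 2) by rewrite mulr_ge0 ?sqrtr_ge0.
have by0 : 0 <= d * y ^+ 2 by rewrite mulr_ge0 ?sqr_ge0 // ltW.
have bz0 : 0 <= d * z ^+ 2 by rewrite mulr_ge0 ?sqr_ge0 // ltW.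
have bK : 0 <= d * (K * (t - (t1 - L ^+ 2))).
  by rewrite (mulr_ge0 (ltW d0)) // (mulr_ge0 (ltW K0)) // subr_ge0.
have {}w0 : m * (t1 - t) + n * Num.sqrt (y ^+ 2 - z ^+ 2) + d * y ^+ 2 + d * z ^+ 2
    + d * (K * (t - (t1 - L ^+ 2))) < b * u (t, (0, y)) - b * u (t, (0, z)).
  by move: w0; rewrite /w /doubled_y; lra.
have large (x : R) : r <= x -> 2 * M <= d * x ^+ 2.
  move=> rx; apply: (le_trans dr); rewrite ler_pM2l // ler_sqr ?nnegrE ?(ltW r0) //.
  exact: (le_trans (ltW r0) rx).
have t0t : t1 - L ^+ 2 < t.
  rewrite lt_neqAle tt0 andbT; apply/eqP => E.
  have : m * (t1 - t) = 2 * M by rewrite -nLM -mL -E; ring.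
  by move: w0 uAB bn by0 bz0 bK; clear; lra.
have g00 : 0 < g.
  rewrite lt_neqAle g0 andbT; apply/eqP => E; move: w0.
  have -> : y = z by rewrite /y -E addr0.
  by rewrite !subrr sqrtr0 mulr0; lra.
have zr' : z < r.
  rewrite ltNge; apply/negP => /large; move: w0 uAB b0 bn by0 bK; clear; lra.
have yr' : y < r.
  rewrite ltNge; apply/negP => /large; move: w0 uAB b0 bn bz0 bK; clear; lra.
(* Positivity of [w] at its maximum bounds [n sqrt (y^2 - z^2)] by [2 M = n L], and [n = m L]; so
   the maximum lies where the barrier is a supersolution. *)
have mn : m * Num.sqrt (y ^+ 2 - z ^+ 2) <= n.
  rewrite -(ler_pM2r L0) mulrAC mL nLM.
  by move: w0 uAB b0 by0 bz0 bK; clear; lra.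
have zy : 0 <= z < y by rewrite zz0 /= ltrDl.
apply: (doubled_y_no_max c1 n0 mn d0 Kc tT' zy (t1 := t1) (t0 := t1 - L ^+ 2)).
- near=> h; apply: (pmax _ _ _); last by rewrite zz0.
    apply/andP; split; last by rewrite lerBlDr (le_trans tt1) // lerDl ltW.
    have : t1 - L ^+ 2 <= t + h * (- 1) by near: h; exact: near_right_affine_ge.
    by rewrite mulrN1.
  by rewrite /y addrAC subrr add0r g0.
- move=> si; near=> h; apply: (pmax _ _ _); [by rewrite tt0| |by rewrite zz0].
  have -> : y + h * si - z = g + h * si by rewrite /y; ring.
  apply/andP; split; first by near: h; exact: near_right_affine_ge.
  have : y + h * si <= r by near: h; exact: near_right_affine_le.
  by apply: le_trans; rewrite lerD2r lerDr.
- move=> si zsi; have gr' : g < r by apply: le_lt_trans yr'; rewrite lerDr.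
  have [e e0 eP] := motion_in_half_space zsi.
  near=> h; have h0 : 0 < h by [].
  apply: (pmax _ _ _); first by rewrite tt0.
    have -> : y - (z + h * si) = g + h * (- si) by rewrite /y; ring.
    apply/andP; split; near: h; [exact: near_right_affine_ge|exact: near_right_affine_le].
  rewrite eP /=; last by rewrite (ltW h0) /=; near: h; exact: nbhs_right_le.
  by near: h; exact: near_right_affine_le.
Unshelve. all: by end_near. Qed.

End independence_of_y.

(** * Independence of time *)

Section liouville.
Context {R : realType} {N : nat} {c : R} {a : 'rV[R]_N} {T M : R}
  {u ut : spacetime R N -> R} {uz : option 'I_N -> spacetime R N -> R}
  {uzz : option 'I_N -> option 'I_N -> spacetime R N -> R}.
Hypothesis uJ : solution_jet c a T u ut uz uzz.
Hypothesis c1 : 0 < 1 + c.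
Hypothesis a1 : \sum_(i < N) a 0 i ^+ 2 < 1.
Hypothesis uM : forall p, @past R N T p -> `|u p| <= M.
Implicit Types (t y s : R) (x : 'rV[R]_N).

(** The two points are mirror images about their midpoint [z], so the two signs in [reflection_le]
    give both inequalities; a negative [s] is handled by exchanging the end points. *)
Lemma shift_x_invariant k t x y s : t <= T -> 0 <= y ->
  u (t, (x + s *: delta_mx 0 k, y)) = u (t, (x, y)).
Proof.
move=> tT y0; wlog s0 : s x / 0 < s => [H|].
  have [s0|s0|->] := ltrgt0P s; first exact: H.
    have := H (- s) (x + s *: delta_mx 0 k); rewrite scaleNr addrK oppr_gt0.
    by move=> /(_ s0) ->.
  by rewrite scale0r addr0.
pose z := x + (s / 2) *: delta_mx 0 k; have s20 : 0 < s / 2 by rewrite divr_gt0.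
have b1 : (1 : R) ^+ 2 = 1 by rewrite expr1n.
have bN : (- 1 : R) ^+ 2 = 1 by rewrite sqrrN expr1n.
have := reflection_le uJ k b1 z c1 a1 uM tT s20 y0.
have := reflection_le uJ k bN z c1 a1 uM tT s20 y0.
rewrite mulr1 mulrN1 scaleNr opprK /z addrK -addrA -scalerDl -splitr => h1 h2.
by apply/eqP; rewrite eq_le h1 h2.
Qed.

(** x is a sum of multiples of coordinate vectors, which are removed one at a time. *)
Lemma x_invariant t x y : t <= T -> 0 <= y -> u (t, (x, y)) = u (t, (0, y)).
Proof.
move=> tT y0; rewrite [x]row_sum_delta; elim: (index_enum _) => [|j r IHr].
  by rewrite big_nil.
by rewrite big_cons addrC shift_x_invariant.
Qed.

Lemma y_invariant t y : t <= T -> 0 <= y -> u (t, (0, y)) = u (t, (0, 0)).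
Proof.
move=> tT; rewrite le_eqVlt => /predU1P[<-//|y0].
have zy : 0 <= (0 : R) < y by rewrite lexx.
have b1 : (1 : R) ^+ 2 = 1 by rewrite expr1n.
have bN : (- 1 : R) ^+ 2 = 1 by rewrite sqrrN expr1n.
have := radial_le uJ x_invariant b1 c1 uM tT zy.
have := radial_le uJ x_invariant bN c1 uM tT zy.
by rewrite !mulN1r !mul1r lerN2 => h1 h2; apply/eqP; rewrite eq_le h1 h2.
Qed.

(** Height 1 serves as an interior point: there the radial equation expresses u_t through
    y-derivatives, which vanish by independence of y. *)
Lemma ut_eq0 t : t <= T -> ut (t, (0, 1)) = 0.
Proof.
move=> tT; rewrite (radial_interior uJ x_invariant tT ltr01).
have shift_y y h : (t, (0, y)) + h *: dir_z None = (t, (0, y + h)) :> spacetime R N.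
  by apply: injective_projections => /=; [|apply: injective_projections => /=];
    rewrite ?scaler0 ?addr0 ?add0r //; congr (_ + _); exact: mulr1.
have uz0 y : 0 <= y -> uz None (t, (0, y)) = 0.
  move=> y0; have Dp : past T (t, (0 : 'rV[R]_N, y)) by apply/pastP.
  apply: (has_derivative_within_cst (jet_derivative_z uJ None Dp)) => h h0.
  have yh : 0 <= y + h by rewrite addr_ge0 // ltW.
  by rewrite shift_y; split; [apply/pastP|rewrite !y_invariant].
have Dp : past T (t, (0 : 'rV[R]_N, 1)) by apply/pastP.
rewrite uz0 ?ler01 // mulr0 addr0.
apply: (has_derivative_within_cst (jet_derivative_zz uJ None None Dp)) => h h0.
have yh : 0 <= 1 + h by rewrite addr_ge0 // ltW.
by rewrite shift_y; split; [apply/pastP|rewrite !uz0].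
Qed.

(** The mean value bound with all constants zero, along the forward segment from [t] to [T]. *)
Lemma t_invariant t : t <= T -> u (t, (0, 1)) = u (T, (0, 1)).
Proof.
rewrite le_eqVlt => /predU1P[->//|tT].
have shift_t h : (t, (0, 1)) + h *: dir_t = (t + h, (0, 1)) :> spacetime R N.
  by apply: injective_projections => /=; [congr (_ + _); exact: mulr1|
    rewrite scaler0 addr0].
have Tt : 0 < T - t by rewrite subr_gt0.
have seg h : 0 <= h <= T - t -> past T ((t, (0, 1)) + h *: dir_t : spacetime R N).
  by move=> /andP[_ hT]; rewrite shift_t; apply/pastP; rewrite -lerBrDl.
have := mean_value_bound (m0 := 0) (m1 := 0) (e := 0) Tt seg (jet_continuous uJ)
  (fun p => jet_derivative_t uJ (p := p)).
rewrite shift_t (addrC t) subrK !mul0r !subr0 normr_le0 subr_eq0 => H.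
apply/esym/eqP; apply: H => h /andP[h0 hT].
rewrite shift_t ut_eq0; first by rewrite !mul0r !subr0 normr0.
by rewrite -lerBrDl ltW.
Qed.

End liouville.

(** * Constancy from the three invariances *)

Theorem corollary7p3 (R : realType) (N : nat) (c : R) (a : 'rV[R]_N)
    (hc : 0 < c + 1) (ha : eucl_norm a < 1)
    (T : R) (u : spacetime R N -> R)
    (hreg : C12 `]-oo, T] u)
    (hbdd : exists M : R,
      forall p, (`]-oo, T] `*` closed_half_space) p -> `|u p| <= M)
    (hsol : solves_on `]-oo, T] c a u)
    (hneu : neumann `]-oo, T] c u) :
  exists k : R, forall p, (`]-oo, T] `*` closed_half_space) p -> u p = k.
Proof.
have [ut [uz [uzz uJ]]] := solution_jet_exists hreg hsol hneu.
have [M uM] := hbdd.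
have c1 : 0 < 1 + c by rewrite addrC.
have a1 : \sum_(i < N) a 0 i ^+ 2 < 1.
  have S0 : 0 <= \sum_(i < N) a 0 i ^+ 2 by apply: sumr_ge0 => i _; exact: sqr_ge0.
  by rewrite -(sqr_sqrtr S0) expr_lt1 // sqrtr_ge0.
(* At time [t], x moves to 0, then y to 0 and back up to height 1; only there does time move to
   [T]. *)
exists (u (T, (0, 1))) => -[t [x y]] /pastP[tT y0].
rewrite (x_invariant uJ c1 a1 uM) // (y_invariant uJ c1 a1 uM) //.
by rewrite -(t_invariant uJ c1 a1 uM tT) [RHS](y_invariant uJ c1 a1 uM).
Qed.
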